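(* Let $K(0)=K^0\in\mathbb{K}$. The solution trajectories of each of the following ODEs converge exponentially to $K^*$: (i) the gradient flow $\dot K(t)=-\nabla C(K)$; (ii) the Gauss–Newton flow $\dot K(t)=-2\big(R+B^T\mathcal{E}(P^K)B\big)^{-1}L^K$, i.e. $\dot K_i=-2(R_i+B_i^T\mathcal{E}_i(P^K)B_i)^{-1}L_i^K$; (iii) the natural policy gradient flow $\dot K(t)=-\nabla C(K)(\mathbf{X}^K)^{-1}$.
   Context: Let $N_s\ge 1$, $\Omega=\{1,\dots,N_s\}$; tuples $V=(V_1,\dots,V_{N_s})$ of matrices are combined componentwise. Markovian jump linear system: $x_{t+1}=A_{\omega(t)}x_t+B_{\omega(t)}u_t$, $A_i\in\mathbb{R}^{d\times d}$, $B_i\in\mathbb{R}^{d\times k}$; $\{\omega(t)\}$ is a time-homogeneous Markov chain on $\Omega$ with transition probabilities $p_{ij}$ and initial distribution $\pi$ with $\pi_i>0$; $x_0$ is random, independent of the chain, with $\mathbb{E}[x_0x_0^T]\succ0$. The system is mean-square stabilizable. $Q=(Q_i)\succ0$, $R=(R_i)\succ0$. For $K=(K_i)$, $K_i\in\mathbb{R}^{k\times d}$, $u_t=-K_{\omega(t)}x_t$ and $C(K)=\mathbb{E}[\sum_{t\ge0}x_t^TQ_{\omega(t)}x_t+u_t^TR_{\omega(t)}u_t]$. $\mathbb{K}$ is the set of $K$ making the closed loop $x_{t+1}=\Gamma_{\omega(t)}x_t$, $\Gamma_i=A_i-B_iK_i$, mean-square stable (equivalently $C(K)<\infty$); $\nabla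 C(K)$ is the gradient of $C$ on $\mathbb{K}$ w.r.t. $\langle V,S\rangle=\sum_i\mathrm{tr}(V_i^TS_i)$. $K^*$ is the optimal gain minimizing $C$ over $\mathbb{K}$. $\mathcal{E}_i(V)=\sum_jp_{ij}V_j$; $\mathcal{T}_j(V)=\sum_ip_{ij}\Gamma_iV_i\Gamma_i^T$. For $K\in\mathbb{K}$: $P^K$ solves $P_i^K=Q_i+K_i^TR_iK_i+\Gamma_i^T\mathcal{E}_i(P^K)\Gamma_i$; $L_i^K=(R_i+B_i^T\mathcal{E}_i(P^K)B_i)K_i-B_i^T\mathcal{E}_i(P^K)A_i$; $X_i(0)=\mathbb{E}[x_0x_0^T\mathbf{1}\{\omega(0)=i\}]$, $\mathbf{X}^K=\sum_{t\ge0}\mathcal{T}^t(X(0))$. *)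

(* Defs.v *)
From HB Require Import structures.
From mathcomp Require Import all_boot all_order all_algebra.
From mathcomp Require Import all_classical all_reals all_analysis.
Set Implicit Arguments. Unset Strict Implicit. Unset Printing Implicit Defensive.
Import Order.TTheory GRing.Theory Num.Theory.
Import numFieldNormedType.Exports.
Local Open Scope classical_set_scope.
Local Open Scope ring_scope.

Section MJLS.
Variables (R : realType) (Ns d k : nat).

Notation gainT := ('I_Ns -> 'M[R]_(k, d)).

Definition posdef (n : nat) (M : 'M[R]_n) : Prop :=
  M^T = M /\ forall v : 'cV[R]_n, v != 0 -> 0 < (v^T *m M *m v) 0 0.

Definition stochastic (p : 'I_Ns -> 'I_Ns -> R) : Prop :=
  (forall i j, 0 <= p i j) /\ (forall i, \sum_j p i j = 1).

Definition init_distr (pi : 'I_Ns -> R) : Prop :=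
  (forall i, 0 < pi i) /\ \sum_i pi i = 1.

Variables (A : 'I_Ns -> 'M[R]_d) (B : 'I_Ns -> 'M[R]_(d, k))
  (p : 'I_Ns -> 'I_Ns -> R) (pi : 'I_Ns -> R) (Sigma0 : 'M[R]_d)
  (Q : 'I_Ns -> 'M[R]_d) (Rc : 'I_Ns -> 'M[R]_k).

Definition Gam (K : gainT) (i : 'I_Ns) : 'M[R]_d := A i - B i *m K i.

(* A mode path (omega(0),...,omega(t)) is w : {ffun 'I_t.+1 -> 'I_Ns}. *)
Definition path_prob_from (t : nat) (w : {ffun 'I_t.+1 -> 'I_Ns}) : R :=
  \prod_(s < t) p (w (widen_ord (leqnSn t) s)) (w (lift ord0 s)).

Definition path_prob (t : nat) (w : {ffun 'I_t.+1 -> 'I_Ns}) : R :=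
  pi (w ord0) * path_prob_from w.

(* state transition: x_t = Gamma_{omega(t-1)} ... Gamma_{omega(0)} x_0 *)
Definition trans (K : gainT) (t : nat) (w : {ffun 'I_t.+1 -> 'I_Ns}) : 'M[R]_d :=
  foldl (fun M (s : 'I_t) => Gam K (w (widen_ord (leqnSn t) s)) *m M)
        1%:M (enum 'I_t).

(* E[x_t^T (Q + K^T R K)_{omega(t)} x_t], with E[x_0 x_0^T] = Sigma0 and
   x_0 independent of the chain *)
Definition stage_cost (K : gainT) (t : nat) : R :=
  \sum_(w : {ffun 'I_t.+1 -> 'I_Ns})
    path_prob w *
    \tr ((Q (w ord_max) + (K (w ord_max))^T *m Rc (w ord_max) *m K (w ord_max))
          *m (trans K w *m Sigma0 *m (trans K w)^T)).

(* C(K) = E[sum_t x_t^T Q x_t + u_t^T R u_t], in the extended reals *)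
Definition cost (K : gainT) : \bar R := (\sum_(0 <= t <oo) (stage_cost K t)%:E)%E.

(* mean-square stability of x_{t+1} = Gamma_{omega(t)} x_t:
   E[|x_t|^2] -> 0 for every initial mode and every initial state *)
Definition ms_second_moment (K : gainT) (i0 : 'I_Ns) (x0 : 'cV[R]_d) (t : nat) : R :=
  \sum_(w : {ffun 'I_t.+1 -> 'I_Ns} | w ord0 == i0)
    path_prob_from w * ((trans K w *m x0)^T *m (trans K w *m x0)) 0 0.

Definition stabilizing (K : gainT) : Prop :=
  forall (i0 : 'I_Ns) (x0 : 'cV[R]_d), ms_second_moment K i0 x0 @ \oo --> (0 : R).

(* finite value of C on the stabilizing set *)
Definition costR (K : gainT) : R := fine (cost K).

Definition tinner (V S : gainT) : R := \sum_i \tr ((V i)^T *m S i).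
Definition tnorm (V : gainT) : R := Num.sqrt (tinner V V).

Definition is_grad (K G : gainT) : Prop :=
  forall eps : R, 0 < eps -> exists2 delta : R, 0 < delta &
    forall V : gainT, tnorm V < delta ->
      stabilizing (fun i => K i + V i) /\
      `| costR (fun i => K i + V i) - costR K - tinner G V | <= eps * tnorm V.

Definition Eop (V : 'I_Ns -> 'M[R]_d) (i : 'I_Ns) : 'M[R]_d := \sum_j p i j *: V j.

Definition is_PK (K : gainT) (P : 'I_Ns -> 'M[R]_d) : Prop :=
  forall i, P i = Q i + (K i)^T *m Rc i *m K i + (Gam K i)^T *m Eop P i *m Gam K i.

Definition LK (K : gainT) (P : 'I_Ns -> 'M[R]_d) (i : 'I_Ns) : 'M[R]_(k, d) :=
  (Rc i + (B i)^T *m Eop P i *m B i) *m K i - (B i)^T *m Eop P i *m A i.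

(* X(t) : X_i(0) = E[x0 x0^T 1{omega(0)=i}] = pi_i Sigma0, X(t+1) = T(X(t)) *)
Fixpoint Xt (K : gainT) (t : nat) : 'I_Ns -> 'M[R]_d :=
  match t with
  | 0 => fun i => pi i *: Sigma0
  | t'.+1 => fun j => \sum_i p i j *: (Gam K i *m Xt K t' i *m (Gam K i)^T)
  end.

Definition XK (K : gainT) (i : 'I_Ns) : 'M[R]_d :=
  \matrix_(a, b) limn (fun n => \sum_(t < n) Xt K t i a b).

(* The three flows, as relations "D is the velocity at K" *)
Definition grad_flow (K D : gainT) : Prop := is_grad K (fun i => - D i).

Definition gn_flow (K D : gainT) : Prop :=
  exists P, is_PK K P /\ forall i,
    D i = - (2%:R *: (invmx (Rc i + (B i)^T *m Eop P i *m B i) *m LK K P i)).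

Definition npg_flow (K D : gainT) : Prop :=
  exists G, is_grad K G /\ forall i, D i = - (G i *m invmx (XK K i)).

Definition is_solution (F : gainT -> gainT -> Prop) (K0 : gainT)
    (Kt : R -> gainT) : Prop :=
  Kt 0 = K0 /\
  (forall t : R, 0 <= t -> stabilizing (Kt t)) /\
  (forall i a b, {within [set t : R | 0 <= t], continuous (fun s => Kt s i a b)}) /\
  (forall t : R, 0 < t -> exists D : gainT,
     (forall i a b, is_derive t (1 : R^o) (fun s => Kt s i a b) (D i a b)) /\ F (Kt t) D).

Definition exp_conv (Kt : R -> gainT) (Kstar : gainT) : Prop :=
  exists c alpha : R, 0 < c /\ 0 < alpha /\
    forall t : R, 0 <= t -> tnorm (fun i => Kt t i - Kstar i) <= c * expR (- (alpha * t)).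

Definition flow_converges (F : gainT -> gainT -> Prop) (K0 Kstar : gainT) : Prop :=
  (exists Kt, is_solution F K0 Kt) /\
  (forall Kt, is_solution F K0 Kt -> exp_conv Kt Kstar).

End MJLS.

(* Main.v *)
Require Import Defs.
From HB Require Import structures.
From mathcomp Require Import all_boot all_order all_algebra.
From mathcomp Require Import all_classical all_reals all_analysis.
From mathcomp Require Import ring lra.
Set Implicit Arguments. Unset Strict Implicit. Unset Printing Implicit Defensive.
Import Order.TTheory GRing.Theory Num.Theory.
Import numFieldNormedType.Exports.
Local Open Scope classical_set_scope.
Local Open Scope ring_scope.

(* Write C(K) = <P^K, X(0)>, S = R + B^T E(P^K) B, and compare two gains by
     C(K') - C(K) = sum_i tr X_i^{K'} (D_i^T S_i D_i + D_i^T L_i + L_i^T D_i),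
   D = K' - K.  It yields grad C = 2 L X^K; with the optimal gain Ks (where
   L = 0) as base point, the coercivity m |K - Ks|^2 <= C(K) - C(Ks); and,
   completing the square with K' = Ks, gradient dominance
   C(K) - C(Ks) <= b sum_i tr L_i^T S_i^-1 L_i.
   As X^K >= X(0) and S >= R on all stabilizing gains, each flow satisfies
   dC/dt <= - alpha (C - C(Ks)) with a constant alpha, so C(K(t)) and then
   K(t) converge exponentially.  For existence, P^K and X^K are bounded on
   the sublevel set {C <= c} and Lipschitz at a uniform scale around it; the
   field cut off by a function of C is therefore globally Lipschitz, and its
   Picard solution cannot leave {C <= C(K^0)}, where the cut-off is 1. *)

(** Explicit estimates take the place of compactness: every constant is the gap of one of the
    finitely many positive definite data matrices ([X0], [Q], [Rc]), a norm of given tuples, or a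
    trace bounded by the cost. Since pi_i > 0, each X_i(0) is itself positive definite, so X^K >=
    X(0) and S >= R give lower bounds uniform over all stabilizing gains. The upper bounds on P^K,
    X^K and K hold on sublevel sets, with constants that depend on the level; therefore the
    dominance estimate is arranged so that its weight is X^{K*}, a fixed tuple. Openness of the
    stabilizing set is part of what has to be proved. For K with C(K) <= c, the matrix P^K is still
    a Lyapunov function for every gain within a radius depending on c only; this gives openness and
    the uniform scale at once. In the existence proof stability and the bound on C depend on each
    other: C can be differentiated only along stabilizing gains, and stability is known only near a
    sublevel set. Advancing by time steps of a fixed length breaks this circle. *)

(** * Limits of real sequences and finite sums *)

Lemma cvg0_le (R : realType) (u : nat -> R) a :
  u @ \oo --> (0 : R) -> (forall n, a <= u n) -> a <= 0.
Proof.
move=> hu h; rewrite -(cvg_lim (@Rhausdorff R) hu); apply: limr_ge.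
  by apply/cvg_ex; exists 0.
by apply: nearW.
Qed.

Lemma cvg_add0 (R : realType) (u v : nat -> R) :
  u @ \oo --> (0 : R) -> v @ \oo --> (0 : R) ->
  (fun n => u n + v n) @ \oo --> (0 : R).
Proof. by move=> hu hv; rewrite -(addr0 0); apply: (cvgD hu hv). Qed.

Lemma cvg_sum_fin (R : realType) (T : Type) (Fl : set_system T) (FF : Filter Fl)
    (I : finType) (u : I -> T -> R) (l : I -> R) :
  (forall i, u i @ Fl --> l i) -> (fun x => \sum_i u i x) @ Fl --> \sum_i l i.
Proof.
move=> h; elim: (index_enum I) => [|i s IH].
  rewrite big_nil (_ : (fun x => _) = fun=> 0); first exact: cvg_cst.
  by apply/funext => x; rewrite big_nil.
rewrite big_cons (_ : (fun x => _) = fun x => u i x + \sum_(j <- s) u j x).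
  exact: (cvgD (h i) IH).
by apply/funext => x; rewrite big_cons.
Qed.

Lemma cvg_sum0 (R : realType) (T : Type) (Fl : set_system T) (FF : Filter Fl)
    (I : finType) (u : I -> T -> R) :
  (forall i, u i @ Fl --> (0 : R)) -> (fun x => \sum_i u i x) @ Fl --> (0 : R).
Proof.
move=> h; have e : \sum_(i : I) (0 : R) = 0 by rewrite big1.
by rewrite -[X in _ --> X]e; exact: cvg_sum_fin.
Qed.

Lemma cvg_scale0 (R : realType) (u : nat -> R) c :
  u @ \oo --> (0 : R) -> (fun n => c * u n) @ \oo --> (0 : R).
Proof. by move=> h; rewrite -(mulr0 c); apply: cvgM => //; apply: cvg_cst. Qed.

Lemma cvg_dom0 (R : realType) (u v : nat -> R) :
  v @ \oo --> (0 : R) -> (forall n, `|u n| <= v n) -> u @ \oo --> (0 : R).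
Proof.
move=> hv h; apply/norm_cvg0P; apply: (squeeze_cvgr _ (cvg_cst 0) hv).
by apply: nearW => n; rewrite normr_ge0 h.
Qed.

(** * Bilinear forms and positive definite matrices *)

Section BilinearForms.
Variable R : realType.
Implicit Types m n : nat.

Definition bf n (M : 'M[R]_n) (x y : 'cV[R]_n) : R := (x^T *m M *m y) 0 0.

(** Symmetry is kept separate: for solutions of fixed point equations, positivity and symmetry are
    obtained by different arguments ([Sta_pos], [Sta_sym]). *)
Definition pos n (M : 'M[R]_n) := forall x, 0 <= bf M x x.

Lemma bfDm n (M N : 'M[R]_n) x y : bf (M + N) x y = bf M x y + bf N x y.
Proof. by rewrite /bf mulmxDr mulmxDl mxE. Qed.

Lemma bfNm n (M : 'M[R]_n) x y : bf (- M) x y = - bf M x y.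
Proof. by rewrite /bf mulmxN mulNmx mxE. Qed.

Lemma bfBm n (M N : 'M[R]_n) x y : bf (M - N) x y = bf M x y - bf N x y.
Proof. by rewrite bfDm bfNm. Qed.

Lemma bfZm n a (M : 'M[R]_n) x y : bf (a *: M) x y = a * bf M x y.
Proof. by rewrite /bf -scalemxAr -scalemxAl mxE. Qed.

Lemma bf_summ n (I : finType) (F : I -> 'M[R]_n) x y :
  bf (\sum_i F i) x y = \sum_i bf (F i) x y.
Proof. by rewrite /bf mulmx_sumr mulmx_suml summxE. Qed.

Lemma bfDl n (M : 'M[R]_n) x x' y : bf M (x + x') y = bf M x y + bf M x' y.
Proof. by rewrite /bf linearD /= !mulmxDl mxE. Qed.

Lemma bfDr n (M : 'M[R]_n) x y y' : bf M x (y + y') = bf M x y + bf M x y'.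
Proof. by rewrite /bf mulmxDr mxE. Qed.

Lemma bfZl n (M : 'M[R]_n) a x y : bf M (a *: x) y = a * bf M x y.
Proof. by rewrite /bf linearZ /= -!scalemxAl mxE. Qed.

Lemma bfZr n (M : 'M[R]_n) a x y : bf M x (a *: y) = a * bf M x y.
Proof. by rewrite /bf -scalemxAr mxE. Qed.

Lemma bfNl n (M : 'M[R]_n) x y : bf M (- x) y = - bf M x y.
Proof. by rewrite -scaleN1r bfZl mulN1r. Qed.

Lemma bfNr n (M : 'M[R]_n) x y : bf M x (- y) = - bf M x y.
Proof. by rewrite -scaleN1r bfZr mulN1r. Qed.

Definition bfE := (bfDl, bfDr, bfNl, bfNr, bfZl, bfZr).

Lemma bfT n (M : 'M[R]_n) x y : bf M^T x y = bf M y x.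
Proof.
have -> : bf M y x = ((y^T *m M *m x)^T) 0 0 by rewrite mxE.
by rewrite !trmx_mul trmxK mulmxA.
Qed.

Lemma bf_conj m n (M : 'M[R]_m) (G : 'M[R]_(m, n)) x y :
  bf (G^T *m M *m G) x y = bf M (G *m x) (G *m y).
Proof. by rewrite /bf trmx_mul !mulmxA. Qed.

Lemma bf_sum n (M : 'M[R]_n) x y :
  bf M x y = \sum_a \sum_b x a 0 * M a b * y b 0.
Proof.
rewrite /bf mxE exchange_big /=; apply: eq_bigr => b _.
by rewrite mxE big_distrl /=; apply: eq_bigr => a _; rewrite mxE.
Qed.

Lemma bf_delta n (M : 'M[R]_n) a b :
  bf M (delta_mx a 0) (delta_mx b 0) = M a b.
Proof. by rewrite /bf trmx_delta -rowE -colE !mxE. Qed.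

Lemma bf1E n (x : 'cV[R]_n) : bf 1%:M x x = \sum_a x a 0 ^+ 2.
Proof.
by rewrite /bf mulmx1 mxE; apply: eq_bigr => a _; rewrite mxE expr2.
Qed.

Lemma bf1_ge0 n (x : 'cV[R]_n) : 0 <= bf 1%:M x x.
Proof. by rewrite bf1E sumr_ge0 // => a _; rewrite sqr_ge0. Qed.

Lemma bf1_gt0 n (x : 'cV[R]_n) : x != 0 -> 0 < bf 1%:M x x.
Proof.
rewrite lt_def bf1_ge0 andbT; apply: contraNneq; rewrite bf1E => /eqP.
rewrite psumr_eq0 => [/allP h|a _]; last by rewrite sqr_ge0.
apply/eqP/matrixP => a b; rewrite ord1 mxE.
by have := h a (mem_index_enum a); rewrite sqrf_eq0 => /eqP.
Qed.

Lemma bf_scalar n a (x : 'cV[R]_n) y : bf a%:M x y = a * bf 1%:M x y.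
Proof. by rewrite -[a%:M]scalemx1 bfZm. Qed.

(** The entrywise l1 norm is submultiplicative, invariant under transposition and dominates the
    trace, so matrix estimates stay free of square roots. *)
Definition nrm m n (M : 'M[R]_(m, n)) : R := \sum_a \sum_b `|M a b|.

Lemma nrm_ge0 m n (M : 'M[R]_(m, n)) : 0 <= nrm M.
Proof. by rewrite !sumr_ge0 // => a _; rewrite sumr_ge0. Qed.

Lemma le_nrm m n (M : 'M[R]_(m, n)) a b : `|M a b| <= nrm M.
Proof.
rewrite /nrm (bigD1 a) //= (bigD1 b) //= -addrA lerDl addr_ge0 ?sumr_ge0 // => i _.
by rewrite sumr_ge0.
Qed.

Lemma nrm_le m n (M : 'M[R]_(m, n)) e :
  (forall a b, `|M a b| <= e) -> nrm M <= (m * n)%:R * e.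
Proof.
move=> h; apply: le_trans (_ : \sum_(a < m) \sum_(b < n) e <= _).
  by apply: ler_sum => a _; apply: ler_sum.
by rewrite !sumr_const !card_ord -mulrnA mulr_natl mulnC.
Qed.

Lemma nrmD m n (M N : 'M[R]_(m, n)) : nrm (M + N) <= nrm M + nrm N.
Proof.
rewrite /nrm -big_split; apply: ler_sum => a _ /=; rewrite -big_split.
by apply: ler_sum => b _ /=; rewrite mxE ler_normD.
Qed.

Lemma nrmZ m n c (M : 'M[R]_(m, n)) : nrm (c *: M) = `|c| * nrm M.
Proof.
rewrite /nrm mulr_sumr; apply: eq_bigr => a _; rewrite mulr_sumr.
by apply: eq_bigr => b _; rewrite mxE normrM.
Qed.

Lemma nrmN m n (M : 'M[R]_(m, n)) : nrm (- M) = nrm M.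
Proof. by rewrite -scaleN1r nrmZ normrN1 mul1r. Qed.

Lemma nrmB m n (M N : 'M[R]_(m, n)) : nrm (M - N) = nrm (N - M).
Proof. by rewrite -nrmN opprB. Qed.

Lemma nrm0 m n : nrm (0 : 'M[R]_(m, n)) = 0.
Proof. by rewrite -(scale0r 0) nrmZ normr0 mul0r. Qed.

Lemma nrmT m n (M : 'M[R]_(m, n)) : nrm M^T = nrm M.
Proof.
rewrite /nrm exchange_big; apply: eq_bigr => a _.
by apply: eq_bigr => b _; rewrite mxE.
Qed.

Lemma nrmM l m n (M : 'M[R]_(l, m)) (N : 'M[R]_(m, n)) :
  nrm (M *m N) <= nrm M * nrm N.
Proof.
rewrite /nrm mulr_suml; apply: ler_sum => a _.
apply: le_trans (_ : \sum_b \sum_j `|M a j| * `|N j b| <= _).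
  apply: ler_sum => b _; rewrite mxE (le_trans (ler_norm_sum _ _ _)) //.
  by apply: ler_sum => j _; rewrite normrM.
rewrite exchange_big mulr_suml; apply: ler_sum => j _.
rewrite -mulr_sumr ler_wpM2l // (bigD1 j) //= lerDl sumr_ge0 // => i _.
by rewrite sumr_ge0.
Qed.

Lemma nrm_tr n (M : 'M[R]_n) : `|\tr M| <= nrm M.
Proof.
apply: le_trans (ler_norm_sum _ _ _) _; apply: ler_sum => a _.
by rewrite (bigD1 a) //= lerDl sumr_ge0.
Qed.

(** Each |x_a y_b| is at most x_a^2 + y_b^2. A sum on the right, rather than a product of norms, is
    the shape that [dom] propagates. *)
Lemma bf_bound n (M : 'M[R]_n) x y :
  `|bf M x y| <= nrm M * (bf 1%:M x x + bf 1%:M y y).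
Proof.
rewrite bf_sum /nrm mulr_suml (le_trans (ler_norm_sum _ _ _)) //.
apply: ler_sum => a _; rewrite mulr_suml (le_trans (ler_norm_sum _ _ _)) //.
apply: ler_sum => b _; rewrite !normrM mulrAC [_ * `|M a b|]mulrC ler_wpM2l //.
apply: le_trans (_ : x a 0 ^+ 2 + y b 0 ^+ 2 <= _).
  rewrite -[x a 0 ^+ 2]real_normK ?num_real // -[y b 0 ^+ 2]real_normK ?num_real //.
  have := sqr_ge0 (`|x a 0| - `|y b 0|).
  have := sqr_ge0 (`|x a 0|); have := sqr_ge0 `|y b 0|; nra.
rewrite !bf1E (bigD1 a) //= [X in _ <= _ + X](bigD1 b) //= lerD // lerDl.
  by rewrite sumr_ge0 // => i _; rewrite sqr_ge0.
by rewrite sumr_ge0 // => i _; rewrite sqr_ge0.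
Qed.

Lemma posdef_bf n (M : 'M[R]_n) x : posdef M -> x != 0 -> 0 < bf M x x.
Proof. by case=> _; apply. Qed.

Lemma posdef_pos n (M : 'M[R]_n) : posdef M -> pos M.
Proof.
move=> hM x; have [->|x0] := eqVneq x 0; last exact/ltW/posdef_bf.
by rewrite /bf mulmx0 mxE.
Qed.

Lemma bf_sym n (M : 'M[R]_n) x y : M^T = M -> bf M x y = bf M y x.
Proof. by move=> {1}<-; rewrite bfT. Qed.

Lemma posdef_unit n (M : 'M[R]_n) : posdef M -> M \in unitmx.
Proof.
case=> sM hM; rewrite -row_free_unit -kermx_eq0; apply/rowV0P => v /sub_kermxP hv.
have [//|v0] := eqVneq v 0.
have vT0 : v^T != 0 by apply: contra_neq v0 => /(congr1 trmx); rewrite trmxK trmx0.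
by have := hM _ vT0; rewrite trmxK hv mul0mx mxE ltxx.
Qed.

Lemma pos_CS n (M : 'M[R]_n) x y : M^T = M -> pos M ->
  bf M x y ^+ 2 <= bf M x x * bf M y y.
Proof.
move=> sM pM; set b := bf M x y.
have key t : 0 <= bf M x x + 2 * t * b + t ^+ 2 * bf M y y.
  have := pM (x + t *: y); rewrite !bfE (bf_sym y x sM) -/b.
  by congr (0 <= _); ring.
have := pM y; rewrite le_eqVlt => /predU1P[y0|y0].
  (* For y^T M y = 0 the quadratic is affine in t; unless its slope b vanishes, this t gives it the
     value -1. *)
  have := key (- (bf M x x + 1) / (2 * b)); rewrite -y0 !mulr0 addr0.
  have [->|b0] := eqVneq b 0; first by rewrite expr0n.
  have -> : 2 * (- (bf M x x + 1) / (2 * b)) * b = - (bf M x x + 1) by field.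
  by rewrite opprD addrA subrr add0r oppr_ge0 ler10.
have := key (- b / bf M y y).
have -> : bf M x x + 2 * (- b / bf M y y) * b + (- b / bf M y y) ^+ 2 * bf M y y
   = (bf M x x * bf M y y - b ^+ 2) / bf M y y by field; exact: lt0r_neq0.
by rewrite pmulr_lge0 ?invr_gt0 // subr_ge0.
Qed.

(* Cauchy-Schwarz between x and M^-1 x gives |x|^4 <= (x^T M x)(x^T M^-1 x),
   which bounds M below without compactness of the sphere. *)
Lemma posdef_gap n (M : 'M[R]_n) : posdef M ->
  exists2 lam, 0 < lam & posdef (M - lam%:M).
Proof.
move=> hM; have uM := posdef_unit hM; have [sM _] := hM.
(* [bf_bound] with x = y gives x^T M^-1 x <= 2 [nrm] |x|^2; the summand 1 makes this strict and c
   positive. *)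
pose c := 2 * nrm (invmx M) + 1.
have c0 : 0 < c by have := nrm_ge0 (invmx M); rewrite /c; lra.
have key x : x != 0 -> bf 1%:M x x / c < bf M x x.
  move=> x0; have hx := bf1_gt0 x0.
  have := pos_CS x (invmx M *m x) sM (posdef_pos hM).
  have e1 : bf M x (invmx M *m x) = bf 1%:M x x.
    by rewrite /bf -!mulmxA (mulmxA M) mulmxV // mul1mx.
  have e2 : bf M (invmx M *m x) (invmx M *m x) = bf (invmx M) x x.
    rewrite -[in RHS](mulmxKV uM (invmx M)) // -[in RHS]mulmxA.
    rewrite /bf trmx_mul trmx_inv sM !mulmxA; congr ((_ *m _) 0 0).
    by rewrite mulmxKV // -[RHS]mulmxA mulVmx ?mulmx1 // -mulmxA mulmxV ?mulmx1.
  rewrite e1 e2 ltr_pdivrMr // => h1.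
  have h2 := bf_bound (invmx M) x x; have h3 := ler_norm (bf (invmx M) x x).
  have h4 := posdef_bf hM x0.
  have h5 : bf (invmx M) x x < c * bf 1%:M x x by rewrite /c; lra.
  have := ltr_pM2l h4 (bf (invmx M) x x) (c * bf 1%:M x x); rewrite h5 => h6.
  have h7 : bf 1%:M x x ^+ 2 < bf M x x * (c * bf 1%:M x x) by apply: le_lt_trans h1 _.
  by rewrite expr2 mulrA ltr_pM2r in h7.
exists c^-1; rewrite ?invr_gt0 //; split; first by rewrite linearB /= sM tr_scalar_mx.
move=> x x0; rewrite -/(bf _ x x) bfBm subr_gt0 bf_scalar mulrC; exact: key.
Qed.

Lemma pos_conj m n (M : 'M[R]_m) (G : 'M[R]_(m, n)) : pos M -> pos (G^T *m M *m G).
Proof. by move=> hM x; rewrite bf_conj. Qed.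

Lemma posdefD n (M N : 'M[R]_n) : posdef M -> N^T = N -> pos N -> posdef (M + N).
Proof.
move=> [sM pM] sN pN; split; first by rewrite linearD /= sM sN.
by move=> v v0; rewrite -/(bf _ v v) bfDm ltr_pwDl // pM.
Qed.

Lemma posdefZ n a (M : 'M[R]_n) : 0 < a -> posdef M -> posdef (a *: M).
Proof.
move=> a0 [sM pM]; split; first by rewrite linearZ /= sM.
by move=> v v0; rewrite -/(bf _ v v) bfZm mulr_gt0 // pM.
Qed.

Lemma posdef_upper n (M : 'M[R]_n) : M^T = M ->
  posdef ((2 * nrm M + 1)%:M - M).
Proof.
move=> sM; split; first by rewrite linearB /= sM tr_scalar_mx.
move=> v v0; rewrite -/(bf _ v v) bfBm bf_scalar.
have := bf1_gt0 v0; have := bf_bound M v v; have := ler_norm (bf M v v); lra.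
Qed.

Lemma bf_drblock m n (D : 'M[R]_n) (x x' : 'cV_m) y y' :
  bf (block_mx 0 0 0 D) (col_mx x y) (col_mx x' y') = bf D y y'.
Proof.
rewrite /bf tr_col_mx mul_row_block !mulmx0 !add0r mul_row_col.
by rewrite mul0mx add0r.
Qed.

(* Peel off one dimension at a time: X = a v v^T + (0 (+) Schur complement). *)
Lemma tr_pos n (X Z : 'M[R]_n) : posdef X -> pos Z -> 0 <= \tr (X *m Z).
Proof.
elim: n X Z => [|n IH] X Z; first by rewrite /mxtrace big_ord0.
rewrite -[n.+1]/(1 + n)%N in X Z * => hX pZ; have [sX pX] := hX.
pose a := ulsubmx X 0 0; pose b := dlsubmx X.
have ea : ulsubmx X = a%:M by rewrite [LHS]mx11_scalar.
have eb : ursubmx X = b^T by rewrite /b trmx_dlsub sX.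
have a0 : 0 < a.
  have : (delta_mx (lshift n 0) 0 : 'cV[R]_(1 + n)) != 0.
    apply/eqP => /matrixP/(_ (lshift n 0) 0); rewrite !mxE !eqxx => /eqP.
    by rewrite oner_eq0.
  by move=> /(posdef_bf hX); rewrite bf_delta /a !mxE.
pose v : 'cV[R]_(1 + n) := col_mx 1%:M (a^-1 *: b).
pose C := drsubmx X - a^-1 *: (b *m b^T).
have eX : X = a *: (v *m v^T) + block_mx 0 0 0 C.
  rewrite -[LHS]submxK ea eb /v tr_col_mx mul_col_row trmx1 mulmx1 mul1mx.
  rewrite scale_block_mx add_block_mx !addr0 linearZ /= mulmx1 scalerA.
  rewrite mulfV ?lt0r_neq0 // scale1r scalerA mulfV ?lt0r_neq0 // scale1r.
  rewrite scalemx1 -scalemxAl -scalemxAr !scalerA mulfV ?lt0r_neq0 // mul1r.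
  by rewrite /C addrC subrK.
have bX (x : 'cV_1) (y : 'cV_n) :
  bf X (col_mx x y) (col_mx x y)
    = a * (x + a^-1 *: (b^T *m y)) 0 0 ^+ 2 + bf C y y.
  rewrite eX bfDm bf_drblock bfZm; congr (_ * _ + _).
  have -> : v *m v^T = v^T^T *m 1%:M *m v^T by rewrite trmxK mulmx1.
  rewrite bf_conj bf1E big_ord1; congr (_ 0 0 ^+ 2).
  by rewrite /v tr_col_mx mul_row_col trmx1 mul1mx linearZ /= -scalemxAl.
have hC : posdef C.
  split.
    by rewrite /C linearB linearZ /= trmx_mul trmxK trmx_drsub sX.
  move=> y y0; rewrite -/(bf C y y).
  have := bX (- (a^-1 *: (b^T *m y))) y.
  rewrite addNr mxE expr0n mulr0 add0r => <-; apply: posdef_bf => //.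
  by apply: contra_neq y0 => /eqP; rewrite col_mx_eq0 => /andP[_ /eqP].
have pZd : pos (drsubmx Z).
  move=> y; have := pZ (col_mx 0 y).
  rewrite -[Z]submxK /bf tr_col_mx mul_row_block mul_row_col trmx0 !mul0mx !add0r.
  by rewrite mulmx0 add0r block_mxKdr.
rewrite eX mulmxDl linearD /= -scalemxAl linearZ /= addr_ge0 ?mulr_ge0 ?(ltW a0) //.
  by rewrite -mulmxA mxtrace_mulC /mxtrace big_ord1 pZ.
rewrite -[Z]submxK mulmx_block !mul0mx !add0r mxtrace_block mxtrace0 add0r.
exact: IH.
Qed.

End BilinearForms.

Section MoreMatrices.
Variable R : realType.

Lemma addmxE m n (M N : 'M[R]_(m, n)) a b : (M + N) a b = M a b + N a b.
Proof. by rewrite mxE. Qed.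

Lemma trmxD m n (M N : 'M[R]_(m, n)) : (M + N)^T = M^T + N^T.
Proof. exact: linearD. Qed.

Lemma trmxZ m n a (M : 'M[R]_(m, n)) : (a *: M)^T = a *: M^T.
Proof. exact: linearZ. Qed.

Lemma trmxN m n (M : 'M[R]_(m, n)) : (- M)^T = - M^T.
Proof. exact: linearN. Qed.

Lemma trmxB m n (M N : 'M[R]_(m, n)) : (M - N)^T = M^T - N^T.
Proof. exact: linearB. Qed.

Lemma oppmxE m n (M : 'M[R]_(m, n)) a b : (- M) a b = - M a b.
Proof. by rewrite mxE. Qed.

Lemma posdef_gaps n N (M : 'I_N -> 'M[R]_n) : (forall i, posdef (M i)) ->
  exists2 lam, 0 < lam & forall i, posdef (M i - lam%:M).
Proof.
move=> h.
have /choice[f hf] i : exists l, 0 < l /\ posdef (M i - l%:M).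
  by have [l l0 hl] := posdef_gap (h i); exists l.
(* As s >= 1 / f i for every i, the number 1 / s is a common gap, positive also for an empty index
   set. *)
pose s := 1 + \sum_i (f i)^-1.
have s0 : 0 <= \sum_i (f i)^-1.
  by apply: sumr_ge0 => i _; rewrite invr_ge0 ltW //; case: (hf i).
have s1 : 0 < s by rewrite /s; lra.
exists s^-1; first by rewrite invr_gt0.
move=> i; have [f0 hi] := hf i.
have le : s^-1 <= f i.
  rewrite invf_ple ?posrE // /s (bigD1 i) //= addrCA lerDl addr_ge0 //.
  by apply: sumr_ge0 => j _; rewrite invr_ge0 ltW //; case: (hf j).
have -> : M i - s^-1%:M = (M i - (f i)%:M) + (f i - s^-1)%:M.
  by rewrite rmorphB /= addrA subrK.
apply: posdefD => //; first by rewrite tr_scalar_mx.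
by move=> x; rewrite bf_scalar mulr_ge0 ?subr_ge0 // bf1_ge0.
Qed.

Lemma posdef_gap_bf n (M : 'M[R]_n) lam x : posdef (M - lam%:M) ->
  lam * bf 1%:M x x <= bf M x x.
Proof. by move=> /posdef_pos/(_ x); rewrite bfBm bf_scalar subr_ge0. Qed.

Lemma tr_ge n (X Z : 'M[R]_n) lam : posdef (X - lam%:M) -> pos Z ->
  lam * \tr Z <= \tr (X *m Z).
Proof.
move=> hX hZ; have := tr_pos hX hZ.
by rewrite mulmxBl linearB /= mul_scalar_mx linearZ subr_ge0.
Qed.

Lemma tr_le n (X Z : 'M[R]_n) : X^T = X -> pos Z ->
  \tr (X *m Z) <= (2 * nrm X + 1) * \tr Z.
Proof.
move=> hX hZ; have := tr_pos (posdef_upper hX) hZ.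
by rewrite mulmxBl linearB /= mul_scalar_mx linearZ subr_ge0.
Qed.

Lemma pos_diag n (P : 'M[R]_n) a : pos P -> 0 <= P a a.
Proof. by move=> /(_ (delta_mx a 0)); rewrite bf_delta. Qed.

Lemma pos_tr_ge0 n (P : 'M[R]_n) : pos P -> 0 <= \tr P.
Proof. by move=> hP; apply: sumr_ge0 => a _; apply: pos_diag. Qed.

Lemma pos_diag_tr n (P : 'M[R]_n) a : pos P -> P a a <= \tr P.
Proof.
move=> hP; rewrite /mxtrace (bigD1 a) //= lerDl sumr_ge0 // => b _.
exact: pos_diag.
Qed.

(** The form at e_a + e_b and e_a - e_b controls the off-diagonal entries by the diagonal ones.
    Hence a trace bounds the whole matrix, which is how the cost bounds P^K and X^K. *)
Lemma pos_nrm n (P : 'M[R]_n) : P^T = P -> pos P -> nrm P <= (n * n)%:R * \tr P.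
Proof.
move=> sP hP; apply: nrm_le => a b.
have h1 := hP (delta_mx a 0 + delta_mx b 0).
have h2 := hP (delta_mx a 0 - delta_mx b 0).
rewrite !bfE !bf_delta in h1 h2.
have e : P b a = P a b by rewrite -[in LHS]sP mxE.
have := pos_diag_tr a hP; have := pos_diag_tr b hP.
by rewrite e in h1 h2; rewrite ler_norml => *; apply/andP; split; lra.
Qed.

Definition sq m n (M : 'M[R]_(m, n)) : R := \tr (M^T *m M).

Lemma sqE m n (M : 'M[R]_(m, n)) : sq M = \sum_b \sum_a M a b ^+ 2.
Proof.
apply: eq_bigr => b _; rewrite mxE; apply: eq_bigr => a _.
by rewrite mxE expr2.
Qed.

Lemma sq_ge0 m n (M : 'M[R]_(m, n)) : 0 <= sq M.
Proof. by rewrite sqE !sumr_ge0 // => a _; rewrite sumr_ge0 // => b _; rewrite sqr_ge0. Qed.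

Lemma sq_entry m n (M : 'M[R]_(m, n)) a b : M a b ^+ 2 <= sq M.
Proof.
rewrite sqE (bigD1 b) //= (bigD1 a) //= -addrA lerDl addr_ge0 // sumr_ge0 // => i _.
  by rewrite sqr_ge0.
by rewrite sumr_ge0 // => j _; rewrite sqr_ge0.
Qed.

Lemma pos_gram m n (M : 'M[R]_(m, n)) : pos (M^T *m M).
Proof. by move=> x; rewrite -[M^T]mulmx1 bf_conj bf1_ge0. Qed.

(* the congruence M^T S M seen as a trace of S against M M^T *)
Lemma tr_conj_ge m n (S : 'M[R]_m) (M : 'M[R]_(m, n)) mu :
  posdef (S - mu%:M) -> mu * sq M <= \tr (M^T *m S *m M).
Proof.
move=> hS; have -> : \tr (M^T *m S *m M) = \tr (S *m (M *m M^T)).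
  by rewrite mulmxA [RHS]mxtrace_mulC mulmxA.
rewrite /sq mxtrace_mulC; by apply: tr_ge => //; have := pos_gram M^T; rewrite trmxK.
Qed.

Lemma nrm_sq m n (M : 'M[R]_(m, n)) : nrm M <= (m * n)%:R * (1 + sq M).
Proof.
apply: nrm_le => a b; have := sq_entry M a b; rewrite -real_normK ?num_real //.
have := sqr_ge0 (`|M a b| - 1); have := normr_ge0 (M a b); nra.
Qed.

End MoreMatrices.

(** * Inverses of matrices bounded below *)

Section InverseForms.
Variables (R : realType) (n : nat) (S : 'M[R]_n) (mu : R).
Hypotheses (mu0 : 0 < mu) (hS : posdef (S - mu%:M)).

Lemma gap_posdef : posdef S.
Proof.
rewrite -(subrK mu%:M S); apply: posdefD => //; first by rewrite tr_scalar_mx.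
by move=> x; rewrite bf_scalar mulr_ge0 ?bf1_ge0 // ltW.
Qed.

Lemma inv_sym : (invmx S)^T = invmx S.
Proof. by rewrite trmx_inv; have [-> _] := gap_posdef. Qed.

Lemma bf_inv x : bf S (invmx S *m x) (invmx S *m x) = bf (invmx S) x x.
Proof.
rewrite -bf_conj inv_sym mulVmx ?mul1mx //; exact/posdef_unit/gap_posdef.
Qed.

Lemma inv_pos : pos (invmx S).
Proof. by move=> x; rewrite -bf_inv; apply/posdef_pos/gap_posdef. Qed.

(** With y = S^-1 x, the gap reads mu |y|^2 <= x^T y; inserting it into |x - mu y|^2 >= 0 leaves mu
    x^T y <= |x|^2. *)
Lemma inv_le : pos (mu^-1%:M - invmx S).
Proof.
move=> x; rewrite bfBm bf_scalar subr_ge0 ler_pdivlMl //.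
have := posdef_gap_bf (invmx S *m x) hS; rewrite bf_inv => h1.
have := bf1_ge0 (x - mu *: (invmx S *m x)).
have e : bf 1%:M x (invmx S *m x) = bf (invmx S) x x by rewrite /bf mulmx1 mulmxA.
rewrite !bfE (bf_sym (invmx S *m x) x) ?trmx1 // e => h2.
have := ler_wpM2l (ltW mu0) h1; lra.
Qed.

Lemma nrm_inv : nrm (invmx S) <= (n * n)%:R * (n%:R * mu^-1).
Proof.
apply: le_trans (pos_nrm inv_sym inv_pos) _; rewrite ler_wpM2l //.
have := pos_tr_ge0 inv_le; rewrite linearB /= subr_ge0 mxtrace_scalar.
by rewrite mulr_natl.
Qed.

Lemma tr_conj_inv_le m (M : 'M[R]_(n, m)) :
  \tr (M^T *m invmx S *m M) <= mu^-1 * sq M.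
Proof.
have := pos_tr_ge0 (pos_conj M inv_le).
rewrite mulmxBr mulmxBl linearB /= subr_ge0 => /le_trans; apply.
by rewrite -scalemx1 -scalemxAr -scalemxAl mulmx1 linearZ.
Qed.

End InverseForms.

(** * Positive operators on tuples of matrices *)

Section PositiveOperator.
Variables (R : realType) (N d : nat).
Notation tup := ('I_N -> 'M[R]_d).
Variables (c : 'I_N -> 'I_N -> R) (M : 'I_N -> 'I_N -> 'M[R]_d).
Hypothesis c_ge0 : forall i j, 0 <= c i j.

(** A common form for the two adjoint operators: [Lop], whose fixed point equation defines P^K, has
    coefficients p i j and matrices Gamma_i; [Top], which propagates second moments, has the
    transposed coefficients and the matrices Gamma_i^T. *)
Definition Phi (V : tup) : tup :=
  fun i => \sum_j c i j *: ((M i j)^T *m V j *m M i j).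

Lemma PhiD V W i : Phi (fun i => V i + W i) i = Phi V i + Phi W i.
Proof.
rewrite /Phi -big_split; apply: eq_bigr => j _ /=.
by rewrite mulmxDr mulmxDl scalerDr.
Qed.

Lemma PhiZ a V i : Phi (fun i => a *: V i) i = a *: Phi V i.
Proof.
rewrite /Phi scaler_sumr; apply: eq_bigr => j _.
by rewrite -scalemxAr -scalemxAl !scalerA mulrC.
Qed.

Lemma PhiB V W i : Phi (fun i => V i - W i) i = Phi V i - Phi W i.
Proof.
have -> : (fun i => V i - W i) = (fun i => V i + (-1) *: W i).
  by apply/funext => j; rewrite scaleN1r.
by rewrite PhiD PhiZ scaleN1r.
Qed.

Lemma PhiT V i : Phi (fun i => (V i)^T) i = (Phi V i)^T.
Proof.
rewrite /Phi raddf_sum; apply: eq_bigr => j _ /=.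
by rewrite linearZ /= !trmx_mul trmxK mulmxA.
Qed.

Lemma bf_Phi V i x y :
  bf (Phi V i) x y = \sum_j c i j * bf (V j) (M i j *m x) (M i j *m y).
Proof. by rewrite bf_summ; apply: eq_bigr => j _; rewrite bfZm bf_conj. Qed.

Lemma Phi_pos V : (forall i, pos (V i)) -> forall i, pos (Phi V i).
Proof. by move=> h i x; rewrite bf_Phi sumr_ge0 // => j _; apply: mulr_ge0; last exact: h. Qed.

(* For symmetric V this is -2 Z <= V <= 2 Z, but it also controls the
   antisymmetric part of V. *)
Definition dom (V Z : tup) :=
  forall i x y, `|bf (V i) x y| <= bf (Z i) x x + bf (Z i) y y.

Lemma Phi_dom V Z : dom V Z -> dom (Phi V) (Phi Z).
Proof.
move=> h i x y; rewrite !bf_Phi -big_split (le_trans (ler_norm_sum _ _ _)) //.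
by apply: ler_sum => j _; rewrite normrM ger0_norm //= -mulrDr ler_wpM2l.
Qed.

Lemma iterPhiD n V W i :
  iter n Phi (fun i => V i + W i) i = iter n Phi V i + iter n Phi W i.
Proof.
elim: n i => //= n IH i; rewrite -PhiD; congr (Phi _ i); exact/funext.
Qed.

Lemma iterPhiZ n a V i : iter n Phi (fun i => a *: V i) i = a *: iter n Phi V i.
Proof. by elim: n i => //= n IH i; rewrite -PhiZ; congr (Phi _ i); exact/funext. Qed.

Lemma iter_pos n V : (forall i, pos (V i)) -> forall i, pos (iter n Phi V i).
Proof. by move=> h; elim: n => //= n IH; apply: Phi_pos. Qed.

Lemma iter_dom n V Z : dom V Z -> dom (iter n Phi V) (iter n Phi Z).
Proof. by move=> h; elim: n => //= n IH; apply: Phi_dom. Qed.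

Definition tnrm (V : tup) := \sum_i nrm (V i).

Lemma dom_tnrm V : dom V (fun=> (tnrm V)%:M).
Proof.
move=> i x y; rewrite !(bf_scalar (tnrm V)) -mulrDr; apply: le_trans (bf_bound _ _ _) _.
rewrite ler_wpM2r ?addr_ge0 ?bf1_ge0 // /tnrm (bigD1 i) //= lerDl sumr_ge0 // => j _.
exact: nrm_ge0.
Qed.

(** Spectral radius below 1, expressed without eigenvalues. *)
Definition Sta := forall V i a b, (fun n => iter n Phi V i a b) @ \oo --> (0 : R).

Lemma Sta_bf V i x y : Sta -> (fun n => bf (iter n Phi V i) x y) @ \oo --> (0 : R).
Proof.
move=> st; rewrite (_ : (fun n => _) =
    fun n => \sum_a \sum_b (x a 0 * y b 0) * iter n Phi V i a b).
  by apply: cvg_sum0 => a; apply: cvg_sum0 => b; apply: cvg_scale0; apply: st.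
apply/funext => n; rewrite bf_sum; apply: eq_bigr => a _; apply: eq_bigr => b _.
by rewrite mulrAC.
Qed.

(** By [dom_tnrm] every tuple is dominated by a multiple of the identity, and [Phi] preserves
    domination, so the iterates of the identity control all others. *)
Lemma Sta_of_bf : (forall i x, (fun n => bf (iter n Phi (fun=> 1%:M) i) x x) @ \oo --> (0 : R))
  -> Sta.
Proof.
move=> h V i a b.
have hd : dom V (fun i => tnrm V *: 1%:M).
  by move=> j x y; rewrite scalemx1; apply: dom_tnrm.
apply: (@cvg_dom0 _ _ (fun n => tnrm V *
    (bf (iter n Phi (fun=> 1%:M) i) (delta_mx a 0) (delta_mx a 0) +
     bf (iter n Phi (fun=> 1%:M) i) (delta_mx b 0) (delta_mx b 0)))).
  by apply: cvg_scale0; apply: cvg_add0.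
move=> n; have := iter_dom n hd i (delta_mx a 0) (delta_mx b 0).
by rewrite bf_delta iterPhiZ !bfZm mulrDr.
Qed.

(** The truncated Neumann series with exact remainder; the comparison results below let n tend to
    infinity in it. *)
Lemma iter_fixpoint n V W : (forall i, V i = Phi V i + W i) ->
  forall i, V i = iter n Phi V i + \sum_(t < n) iter t Phi W i.
Proof.
move=> h; elim: n => [|n IH] i; first by rewrite big_ord0 addr0.
have e := funext IH.
rewrite big_ord_recl /= {1}h {1}e.
rewrite PhiD addrAC addrA; congr (_ + _ + _).
rewrite /Phi [RHS]exchange_big; apply: eq_bigr => j _ /=.
by rewrite mulmx_sumr mulmx_suml scaler_sumr.
Qed.

(** The Neumann partial sums are nonnegative, so V dominates its own iterates, which tend to 0. *)
Lemma Sta_pos V W : Sta -> (forall i, V i = Phi V i + W i) ->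
  (forall i, pos (W i)) -> forall i, pos (V i).
Proof.
move=> st h pW i x; rewrite -oppr_le0.
have hc := Sta_bf (fun i => V i) i x x st.
have : (fun n => - bf (iter n Phi V i) x x) @ \oo --> (0 : R).
  by rewrite -oppr0; apply: cvgN.
move/cvg0_le; apply => n; rewrite lerN2 (iter_fixpoint n h i) bfDm lerDl bf_summ.
by apply: sumr_ge0 => t _; apply: iter_pos.
Qed.

(** Domination holds term by term between the Neumann sums of V and U; the remainders vanish in the
    limit. *)
Lemma Sta_dom V W U Z : Sta -> (forall i, V i = Phi V i + W i) ->
  (forall i, U i = Phi U i + Z i) -> dom W Z -> dom V U.
Proof.
move=> st hV hU hd i x y; rewrite -subr_le0.
apply: (@cvg0_le _ (fun n => `|bf (iter n Phi V i) x y|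
   - (bf (iter n Phi U i) x x + bf (iter n Phi U i) y y))).
  rewrite -[0 as X in _ --> X](subrr 0); apply: cvgB.
    by apply/norm_cvg0P; apply: Sta_bf.
  by apply: cvg_add0; apply: Sta_bf.
move=> n; rewrite lerBlDr -addrA.
rewrite {1}(iter_fixpoint n hV i) bfDm (le_trans (ler_normD _ _)) // lerD2l.
rewrite (iter_fixpoint n hU i) !bfDm (addrACA (bf (iter n Phi U i) x x)) addKr !bf_summ -big_split.
rewrite (le_trans (ler_norm_sum _ _ _)) //; apply: ler_sum => t _.
exact: iter_dom.
Qed.

Lemma Sta_inj V : Sta -> (forall i, V i = Phi V i) -> forall i, V i = 0.
Proof.
move=> st h i; apply/matrixP => a b; rewrite mxE.
have e n : iter n Phi V = V by elim: n => //= n ->; apply/funext => j.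
have := st V i a b; under eq_fun do rewrite e.
by move=> /(cvg_lim (@Rhausdorff R)); rewrite lim_cst //; exact: Rhausdorff.
Qed.

(** 1 - [Phi] is injective by [Sta_inj], hence surjective in finite dimension; no series has to be
    summed. *)
Lemma Sta_solve W : Sta -> exists V, forall i, V i = Phi V i + W i.
Proof.
move=> st.
(* Tuples are encoded as finite functions here because these carry the structure of a
   finite-dimensional vector space. *)
pose g (v : {ffun 'I_N -> 'M[R]_d}) : {ffun 'I_N -> 'M[R]_d} :=
  [ffun i => v i - Phi v i].
have glin : linear g.
  move=> a u v; apply/ffunP => i; rewrite !ffunE.
  have -> : (a *: u + v : {ffun _}) = (fun j => a *: u j + v j) :> tup.
    by apply/funext => j; rewrite !ffunE.
  by rewrite PhiD PhiZ scalerBr opprD addrACA.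
pose gL : {linear {ffun 'I_N -> 'M[R]_d} -> {ffun 'I_N -> 'M[R]_d}} :=
  HB.pack g (GRing.isLinear.Build _ _ _ _ g glin).
have k0 : lker (linfun gL) == 0%VS.
  apply/lker0P => u v; rewrite !lfunE /= => e; apply/eqP; rewrite -subr_eq0; apply/eqP.
  have : g (u - v) = 0.
    by have := linearB gL u v; rewrite /= e subrr.
  move=> /ffunP e0; apply/ffunP => i; rewrite [RHS]ffunE; apply: (Sta_inj st) => {}i.
  by have := e0 i; rewrite ffunE [RHS]ffunE => /eqP; rewrite subr_eq0 => /eqP.
have : [ffun i => W i] \in limg (linfun gL) by rewrite lker0_limgf // memvf.
case/memv_imgP => v _; rewrite lfunE /= => /ffunP e; exists v => i.
by have := e i; rewrite !ffunE => ->; rewrite addrC subrK.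
Qed.

(** From Z - Phi Z >= q and Z <= m follows Phi Z <= r Z with r = 1 - q / m, so the iterates of Z
    decay geometrically. Since q 1 <= Z, those of the identity do too. *)
Lemma Lyapunov_Sta Z q : 0 < q -> (forall i, pos (Z i)) ->
  (forall i, pos (Z i - Phi Z i - q%:M)) -> Sta.
Proof.
move=> q0 pZ hZ.
(* 2 [tnrm Z] bounds Z by [dom_tnrm]; adding q gives q / m <= 1, hence 0 <= r < 1. *)
pose m := 2 * tnrm Z + q.
have tn0 : 0 <= tnrm Z by apply: sumr_ge0 => i _; apply: nrm_ge0.
have m0 : 0 < m by rewrite /m; lra.
have Zm i x : bf (Z i) x x <= m * bf 1%:M x x.
  have := dom_tnrm Z i x x; rewrite !(bf_scalar (tnrm Z)).
  have := ler_norm (bf (Z i) x x); have := bf1_ge0 x; rewrite /m; nra.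
have hq i x : q * bf 1%:M x x <= bf (Z i) x x - bf (Phi Z i) x x.
  by have := hZ i x; rewrite !bfBm bf_scalar subr_ge0.
pose r := 1 - q / m.
have r0 : 0 <= r by rewrite /r subr_ge0 ler_pdivrMr // mul1r /m; lra.
have r1 : r < 1 by rewrite /r ltrBlDr ltrDl divr_gt0.
have step i x : bf (Phi Z i) x x <= r * bf (Z i) x x.
  have h1 := hq i x; have h2 := Zm i x.
  have : q / m * bf (Z i) x x <= q * bf 1%:M x x.
    by rewrite -mulrA ler_wpM2l ?(ltW q0) // mulrC ler_pdivrMr // mulrC.
  rewrite /r; lra.
have stepn n i x : bf (iter n Phi Z i) x x <= r ^+ n * bf (Z i) x x.
  elim: n i x => [|n IH] i x; first by rewrite expr0 mul1r.
  rewrite iterSr /=.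
  have h := @iter_pos n (fun i => r *: Z i - Phi Z i) _ i x.
  have e1 : iter n Phi (fun i => r *: Z i - Phi Z i) i =
     r *: iter n Phi Z i - iter n Phi (Phi Z) i.
    have -> : (fun i => r *: Z i - Phi Z i) = fun i => r *: Z i + (-1) *: Phi Z i.
      by apply/funext => j; rewrite scaleN1r.
    by rewrite iterPhiD !iterPhiZ scaleN1r.
  rewrite e1 bfBm subr_ge0 bfZm in h.
  apply: le_trans (h _) _.
    by move=> j y; rewrite bfBm bfZm subr_ge0.
  by rewrite exprS -mulrA ler_wpM2l.
apply: Sta_of_bf => i x.
apply: (@cvg_dom0 _ _ (fun n => (q^-1 * bf (Z i) x x) * r ^+ n)).
  by apply: cvg_scale0; apply: cvg_expr; rewrite ger0_norm.
move=> n; rewrite ger0_norm; last by apply: iter_pos => // j y; apply: bf1_ge0.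
rewrite -mulrA ler_pdivlMl //.
rewrite [X in _ <= X]mulrC; apply: le_trans (stepn n i x).
have := @iter_pos n (fun i => Z i + (-1) *: (q *: 1%:M)) _ i x.
rewrite iterPhiD !iterPhiZ bfDm !bfZm mulN1r subr_ge0; apply => j y.
rewrite bfDm !bfZm mulN1r subr_ge0; apply: le_trans (hq j y) _.
by rewrite lerBlDr lerDl; apply: Phi_pos.
Qed.

End PositiveOperator.

Section Fixpoints.
Variables (R : realType) (N d : nat) (c : 'I_N -> 'I_N -> R) (M : 'I_N -> 'I_N -> 'M[R]_d).
Hypothesis st : Sta c M.

Lemma Sta_uniq V V' W : (forall i, V i = Phi c M V i + W i) ->
  (forall i, V' i = Phi c M V' i + W i) -> V = V'.
Proof.
move=> h h'; apply/funext => i; apply/eqP; rewrite -subr_eq0; apply/eqP.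
apply: (Sta_inj (V := fun i => V i - V' i) st) => {}i.
by rewrite PhiB [in LHS]h [in LHS]h' opprD addrACA subrr addr0.
Qed.

Lemma Sta_sym V W : (forall i, V i = Phi c M V i + W i) ->
  (forall i, (W i)^T = W i) -> forall i, (V i)^T = V i.
Proof.
move=> h sW i; suff /(congr1 (fun f => f i)) : (fun i => (V i)^T) = V by [].
apply: (Sta_uniq _ h) => {}i; by rewrite PhiT -[in RHS]sW -linearD /= -h.
Qed.

(** As Z >= q, the source W is dominated by (w / q) Z, hence V by (w / q) U. A known solution U thus
    measures the inverse of 1 - [Phi], without any rate of decay. In the applications V is a
    difference of two P^K or of two X^K, and U the one at the second gain. *)
Lemma fix_lip V W U Z w q : (forall i j, 0 <= c i j) -> 0 < q ->
  (forall i, V i = Phi c M V i + W i) -> (forall i, U i = Phi c M U i + Z i) ->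
  (forall i, nrm (W i) <= w) -> (forall i, posdef (Z i - q%:M)) ->
  forall i, nrm (V i) <= (d * d)%:R * (2 * (w / q) * nrm (U i)).
Proof.
move=> c0 q0 hV hU hW hZ i.
have w0 : 0 <= w by exact: le_trans (nrm_ge0 _) (hW i).
have hd : dom V (fun i => (w / q) *: U i).
  apply: (Sta_dom c0 st hV (Z := fun i => (w / q) *: Z i)) => j.
    by rewrite PhiZ -scalerDr -hU.
  move=> x y; apply: le_trans (bf_bound _ _ _) _; rewrite !bfZm -mulrDr.
  apply: le_trans (_ : w * (bf 1%:M x x + bf 1%:M y y) <= _).
    by rewrite ler_wpM2r ?addr_ge0 ?bf1_ge0.
  rewrite -mulrA ler_wpM2l // mulrC ler_pdivlMr // mulrC mulrDr.
  by rewrite lerD // posdef_gap_bf.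
apply: nrm_le => a b; have := hd i (delta_mx a 0) (delta_mx b 0).
rewrite !bf_delta !mxE => /le_trans; apply; rewrite -mulrDr -mulrA mulrCA ler_wpM2l //.
  by rewrite divr_ge0 // ltW.
have := le_nrm (U i) a a; have := le_nrm (U i) b b.
have := ler_norm (U i a a); have := ler_norm (U i b b); lra.
Qed.

End Fixpoints.

(** * Mode paths *)

Section Paths.
Variables (R : realType) (Ns d k : nat).
Variables (A : 'I_Ns -> 'M[R]_d) (B : 'I_Ns -> 'M[R]_(d, k))
  (p : 'I_Ns -> 'I_Ns -> R).
Hypothesis p_ge0 : forall i j, 0 <= p i j.
Notation gainT := ('I_Ns -> 'M[R]_(k, d)).
Notation tup := ('I_Ns -> 'M[R]_d).
Implicit Types (K : gainT) (V W : tup).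

Definition Lop K : tup -> tup := Phi p (fun i _ => Gam A B K i).
Definition Top K : tup -> tup :=
  Phi (fun j i => p i j) (fun _ i => (Gam A B K i)^T).

Lemma LopE K V i : Lop K V i = (Gam A B K i)^T *m Eop p V i *m Gam A B K i.
Proof.
rewrite /Lop /Phi /Eop mulmx_sumr mulmx_suml; apply: eq_bigr => j _.
by rewrite -scalemxAr -scalemxAl.
Qed.

Lemma TopE K V j :
  Top K V j = \sum_i p i j *: (Gam A B K i *m V i *m (Gam A B K i)^T).
Proof. by apply: eq_bigr => i _; rewrite trmxK. Qed.

Lemma XtE (pi : 'I_Ns -> R) (Sigma0 : 'M[R]_d) K t :
  Xt A B p pi Sigma0 K t = iter t (Top K) (fun i => pi i *: Sigma0).
Proof. by elim: t => //= t ->; apply/funext => j; rewrite TopE. Qed.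

Definition ip V W : R := \sum_i \tr (V i *m W i).

Lemma ipC V W : ip V W = ip W V.
Proof. by apply: eq_bigr => i _; rewrite mxtrace_mulC. Qed.

(** Move one Gamma_i around the trace: for the pairing tr(V W), [Top] is the adjoint of [Lop]. *)
Lemma ip_dual K V W : ip (Top K V) W = ip V (Lop K W).
Proof.
rewrite /ip; under eq_bigr do rewrite TopE mulmx_suml linear_sum.
rewrite exchange_big; apply: eq_bigr => i _ /=.
rewrite LopE /Eop mulmx_sumr mulmx_suml mulmx_sumr linear_sum; apply: eq_bigr => j _ /=.
rewrite -!scalemxAl -!scalemxAr -scalemxAl -scalemxAr !linearZ /=; congr (_ * _).
by rewrite -!mulmxA mxtrace_mulC !mulmxA.
Qed.

Lemma ip_dual_iter K n V W : ip (iter n (Top K) V) W = ip V (iter n (Lop K) W).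
Proof. by elim: n W => //= n IH W; rewrite ip_dual IH -iterSr. Qed.

Lemma ip_cvg0 (u : nat -> tup) V :
  (forall i a b, (fun n => u n i a b) @ \oo --> (0 : R)) ->
  (fun n => ip V (u n)) @ \oo --> (0 : R).
Proof.
move=> h; rewrite (_ : (fun n => _) =
    fun n => \sum_i \sum_a \sum_b (V i a b) * u n i b a).
  by apply: cvg_sum0 => i; apply: cvg_sum0 => a; apply: cvg_sum0 => b; apply: cvg_scale0.
apply/funext => n; apply: eq_bigr => i _; apply: eq_bigr => a _.
by rewrite mxE.
Qed.

(** Stability passes to the adjoint: an entry of T^n V is the pairing of V with L^n of an elementary
    tuple. *)
Lemma Sta_Top K : Sta p (fun i _ => Gam A B K i) ->
  Sta (fun j i => p i j) (fun _ i => (Gam A B K i)^T).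
Proof.
move=> st V i a b.
(* The indices are swapped because tr(V E) picks the entry of V transposed to that of E. *)
pose E : tup := fun j => if j == i then delta_mx b a else 0.
have e n : iter n (Top K) V i a b = ip V (iter n (Lop K) E).
  rewrite -ip_dual_iter /ip (bigD1 i) //= big1 => [|j /negbTE ji].
    rewrite addr0 /E eqxx /mxtrace (bigD1 a) //= big1 => [|j ja].
      rewrite addr0 mxE (bigD1 b) //= big1 ?addr0 => [|j jb].
        by rewrite mxE !eqxx mulr1.
      by rewrite mxE (negbTE jb) mulr0.
    by rewrite mxE big1 // => l _; rewrite mxE (negbTE ja) andbF mulr0.
  by rewrite /E ji mulmx0 mxtrace0.
rewrite (_ : (fun n => _) = fun n => ip V (iter n (Lop K) E)); last exact/funext.
by apply: ip_cvg0 => j c f; apply: st.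
Qed.

(** Appends j at the end of a path: adding the last transition is what one application of [Top]
    does. *)
Definition ext t (w : {ffun 'I_t.+1 -> 'I_Ns}) (j : 'I_Ns) : {ffun 'I_t.+2 -> 'I_Ns} :=
  [ffun s => if unlift ord_max s is Some s' then w s' else j].

Lemma ext_widen t (w : {ffun 'I_t.+1 -> 'I_Ns}) j s :
  ext w j (widen_ord (leqnSn t.+1) s) = w s.
Proof.
have -> : widen_ord (leqnSn t.+1) s = lift ord_max s by exact/val_inj/esym/lift_max.
by rewrite ffunE liftK.
Qed.

Lemma ext_max t (w : {ffun 'I_t.+1 -> 'I_Ns}) j : ext w j ord_max = j.
Proof. by rewrite ffunE unlift_none. Qed.

Lemma ext_lift0 t (w : {ffun 'I_t.+1 -> 'I_Ns}) j (s : 'I_t) :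
  ext w j (lift ord0 (widen_ord (leqnSn t) s)) = w (lift ord0 s).
Proof. by rewrite -(ext_widen w j); congr (ext w j _); apply/val_inj. Qed.

Lemma ext0 t (w : {ffun 'I_t.+1 -> 'I_Ns}) j : ext w j ord0 = w ord0.
Proof. by rewrite -(ext_widen w j); congr (ext w j _); apply/val_inj. Qed.

Lemma sum_ext (V : nmodType) t (F : {ffun 'I_t.+2 -> 'I_Ns} -> V) j :
  \sum_(w : {ffun 'I_t.+2 -> 'I_Ns} | w ord_max == j) F w = \sum_w F (ext w j).
Proof.
rewrite (reindex_onto (fun w => ext w j)
  (fun w => [ffun s => w (widen_ord (leqnSn t.+1) s)])) => [|w /eqP wj].
  apply: eq_bigl => w; rewrite ext_max eqxx /=; apply/eqP/ffunP => s.
  by rewrite ffunE ext_widen.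
apply/ffunP => s; rewrite ffunE; case: unliftP => [s' ->|->] //.
by rewrite ffunE; congr (w _); exact/val_inj/esym/lift_max.
Qed.

Lemma path_prob_ext t (w : {ffun 'I_t.+1 -> 'I_Ns}) j :
  path_prob_from p (ext w j) = path_prob_from p w * p (w ord_max) j.
Proof.
rewrite /path_prob_from big_ord_recr /=; congr (_ * p _ _).
- by apply: eq_bigr => s _; rewrite ext_widen ext_lift0.
- by rewrite ext_widen.
- by rewrite -[RHS](ext_max w j); congr (ext w j _); apply/val_inj.
Qed.

Lemma trans_ext K t (w : {ffun 'I_t.+1 -> 'I_Ns}) j :
  trans A B K (ext w j) = Gam A B K (w ord_max) *m trans A B K w.
Proof.
rewrite /trans enum_ordSr foldl_rcons ext_widen; congr (_ *m _).
elim: (enum 'I_t) (1%:M : 'M[R]_d) => //= s l IH M.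
by rewrite ext_widen IH.
Qed.

(** Induction on t, splitting by the last mode but one. V may depend on the initial mode: V = X(0)
    yields the stage costs, and V = x0 x0^T at a single mode yields [ms_second_moment]. *)
Lemma path_sum K t V j :
  \sum_(w : {ffun 'I_t.+1 -> 'I_Ns} | w ord_max == j)
     path_prob_from p w *: (trans A B K w *m V (w ord0) *m (trans A B K w)^T)
  = iter t (Top K) V j.
Proof.
elim: t j => [|t IH] j.
  rewrite (big_pred1 [ffun=> j]) => [|w].
    rewrite /path_prob_from big_ord0 scale1r /trans enum_ord0 /= ffunE.
    by rewrite trmx1 mulmx1 mul1mx.
  apply/eqP/eqP => [<-|->]; last by rewrite ffunE.
  by apply/ffunP => s; rewrite ffunE; congr (w _); rewrite ord1 [RHS]ord1.
rewrite sum_ext iterS TopE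
  (partition_big (fun w : {ffun 'I_t.+1 -> 'I_Ns} => w ord_max) xpredT) //=.
apply: eq_bigr => i _; rewrite -IH mulmx_sumr mulmx_suml scaler_sumr.
apply: eq_bigr => w /eqP <-.
rewrite path_prob_ext trans_ext ext0 trmx_mul -!scalemxAr -scalemxAl scalerA mulrC.
by rewrite !mulmxA.
Qed.

Lemma stage_costE (pi : 'I_Ns -> R) (Sigma0 : 'M[R]_d) (Q : tup)
   (Rc : 'I_Ns -> 'M[R]_k) K t :
  stage_cost A B p pi Sigma0 Q Rc K t =
  ip (fun i => Q i + (K i)^T *m Rc i *m K i) (Xt A B p pi Sigma0 K t).
Proof.
rewrite XtE /stage_cost /ip
  (partition_big (fun w : {ffun 'I_t.+1 -> 'I_Ns} => w ord_max) xpredT) //=.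
apply: eq_bigr => j _; rewrite -path_sum mulmx_sumr linear_sum.
apply: eq_bigr => w /eqP <- /=.
rewrite -!scalemxAr -scalemxAl -scalemxAr scalerA linearZ /=.
by rewrite /path_prob [pi _ * _]mulrC.
Qed.

(** The second moment is the pairing of T^t V with the identity; duality moves the iterates onto the
    identity, where [Sta_of_bf] can use them. *)
Lemma ms_second_momentE K i0 x0 t :
  ms_second_moment A B p K i0 x0 t = bf (iter t (Lop K) (fun=> 1%:M) i0) x0 x0.
Proof.
pose V : tup := fun i => if i == i0 then x0 *m x0^T else 0.
have -> : bf (iter t (Lop K) (fun=> 1%:M) i0) x0 x0
    = ip V (iter t (Lop K) (fun=> 1%:M)).
  rewrite /ip (bigD1 i0) //= big1 => [|j /negbTE ji].
    by rewrite addr0 /V eqxx -mulmxA mxtrace_mulC /bf /mxtrace big_ord1.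
  by rewrite /V ji mul0mx mxtrace0.
rewrite -ip_dual_iter /ms_second_moment /ip.
under [RHS]eq_bigr do rewrite mulmx1 -path_sum linear_sum.
rewrite big_mkcond
  (partition_big (fun w : {ffun 'I_t.+1 -> 'I_Ns} => w ord_max) xpredT) //=.
apply: eq_bigr => j _; apply: eq_bigr => w _; rewrite linearZ /= /V; case: ifP => _; last first.
  by rewrite mulmx0 mul0mx mxtrace0 mulr0.
congr (_ * _); rewrite [in RHS]mulmxA -[in RHS]mulmxA -trmx_mul [RHS]mxtrace_mulC.
by rewrite /mxtrace big_ord1.
Qed.

Lemma stabilizingP K : stabilizing A B p K <-> Sta p (fun i _ => Gam A B K i).
Proof.
have e i x : ms_second_moment A B p K i x =
    fun t => bf (iter t (Lop K) (fun=> 1%:M) i) x x.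
  by apply/funext => t; rewrite ms_second_momentE.
split=> [h|st i0 x0]; last by rewrite e; apply: Sta_bf.
by apply: Sta_of_bf => // i x; have := h i x; rewrite e.
Qed.

End Paths.

(** * Picard-Lindelof *)

Section Antiderivative.
Variable R : realType.
Implicit Types f g df dg : R -> R.

Lemma derive_le0_le f df (a b : R) : a <= b ->
  (forall t : R, a < t -> t < b -> is_derive t 1 f (df t)) ->
  {within `[a, b], continuous f} ->
  (forall t : R, a < t -> t < b -> df t <= 0) -> f b <= f a.
Proof.
rewrite le_eqVlt => /predU1P[->//|ab] hd hc h.
have hd' x : x \in `]a, b[%R -> is_derive x 1 f (df x).
  by rewrite in_itv => /andP[]; apply: hd.
have [x] := MVT ab hd' hc.
rewrite in_itv => /andP[ax xb] e; rewrite -subr_le0 e.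
by rewrite mulr_le0_ge0 ?h // subr_ge0 ltW.
Qed.

(** A comparison by derivatives, used in place of norm inequalities for integrals. *)
Lemma derive_norm_le f df g dg (a b : R) : a <= b ->
  (forall t : R, a < t -> t < b -> is_derive t 1 f (df t)) ->
  {within `[a, b], continuous f} ->
  (forall t : R, a < t -> t < b -> is_derive t 1 g (dg t)) ->
  {within `[a, b], continuous g} ->
  (forall t : R, a < t -> t < b -> `|df t| <= dg t) -> `|f b - f a| <= g b - g a.
Proof.
move=> ab fd fc gd gc h; rewrite ler_norml; apply/andP; split.
  have : - f b - g b <= - f a - g a.
    apply: (@derive_le0_le (fun t => - f t - g t) (fun t => - df t - dg t) a b ab)
      => [t ta tb|x|t ta tb].
    - have := fd t ta tb; have := gd t ta tb => ? ?.
      exact: is_deriveB.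
    - by apply: cvgB; [apply: cvgN; apply: fc|apply: gc].
    - by have := h t ta tb; rewrite ler_norml => /andP[]; lra.
  lra.
have : f b - g b <= f a - g a.
  apply: (@derive_le0_le (fun t => f t - g t) (fun t => df t - dg t) a b ab) => [t ta tb|x|t ta tb].
  - have := fd t ta tb; have := gd t ta tb => ? ?.
    exact: is_deriveB.
  - by apply: cvgB; [apply: fc|apply: gc].
  - by have := h t ta tb; rewrite ler_norml => /andP[]; lra.
lra.
Qed.

Definition lipschitz_time M f := forall s t, `|f s - f t| <= M * `|s - t|.

Lemma lipschitz_time_continuous M f : lipschitz_time M f -> continuous f.
Proof.
move=> h t; apply/cvgrPdist_lt => e e0.
have M1 : 0 < `|M| + 1 by rewrite ltr_wpDl.
near=> s; apply: le_lt_trans (h _ _) _.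
apply: le_lt_trans (_ : (`|M| + 1) * `|t - s| < _).
  by rewrite ler_wpM2r // (le_trans (ler_norm M)) // lerDl.
rewrite mulrC -ltr_pdivlMr //; near: s.
by apply: (@cvgr_dist_lt _ _ _ (nbhs t) _ id); [exact: cvg_id|rewrite divr_gt0].
Unshelve. all: by end_near. Qed.

(** The base point -1 makes 0 interior, so the integral is differentiable, hence continuous, at 0
    too. Clamping t at 0 extends the antiderivative by 0 to negative times, which makes Picard
    iterates Lipschitz on the whole line. *)
Definition antid f (t : R) : R :=
  \int[lebesgue_measure]_(x in `[- 1, Num.max t 0]) f x
  - \int[lebesgue_measure]_(x in `[- 1, 0]) f x.

Lemma antid0 f : antid f 0 = 0.
Proof. by rewrite /antid maxxx subrr. Qed.

Let F f (t : R) : R := \int[lebesgue_measure]_(x in `[- 1, t]) f x.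

Lemma F_derive f (t : R) : continuous f -> -1 < t -> is_derive t 1 (F f) (f t).
Proof.
move=> fc t0.
have [] := @continuous_FTC1_closed R f (- 1) t (t + 1) _ _ t0 (fc t).
- by rewrite ltrDl.
- apply: continuous_compact_integrable; first exact: segment_compact.
  exact: continuous_subspaceT.
by move=> dF e; exact: (DeriveDef dF (etrans (esym (derive1E _ _)) e)).
Qed.

Lemma antid_derive f (t : R) : continuous f -> 0 < t -> is_derive t 1 (antid f) (f t).
Proof.
move=> fc t0.
have h : is_derive t 1 (fun s => F f s - F f 0) (f t - 0).
  have := F_derive fc (lt_trans (ltrN10 R) t0) => ?.
  have : is_derive t 1 (cst (F f 0)) 0 by apply: is_derive_cst.
  by move=> ?; apply: is_deriveB.
rewrite -[f t]subr0; apply: near_eq_is_derive h.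
near=> s; rewrite /antid /F max_l //.
by near: s; apply: filterS (lt_nbhsr t0) => y /ltW.
Unshelve. all: by end_near. Qed.

Lemma norm_max_le (s t c : R) : `|Num.max s c - Num.max t c| <= `|s - t|.
Proof.
have h1 := ler_norm (s - t); have h2 := ler_norm (t - s); rewrite distrC in h2.
rewrite ler_norml /Order.max; case: ltP => hs; case: ltP => ht; apply/andP; split; lra.
Qed.

Lemma norm_min_le (s t c : R) : `|Num.min s c - Num.min t c| <= `|s - t|.
Proof.
have h1 := ler_norm (s - t); have h2 := ler_norm (t - s); rewrite distrC in h2.
rewrite ler_norml /Order.min; case: ltP => hs; case: ltP => ht; apply/andP; split; lra.
Qed.

Lemma antid_lipschitz f M : continuous f -> (forall t, `|f t| <= M) ->
  lipschitz_time M (antid f).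
Proof.
move=> fc h.
have M0 : 0 <= M by apply: le_trans (h 0).
have key s t : 0 <= s -> s <= t -> `|F f t - F f s| <= M * t - M * s.
  move=> s0 st; apply: (@derive_norm_le _ f ( *%R M) (fun=> M)) => //.
  - move=> u su _; apply: F_derive => //; apply: le_lt_trans su; apply: le_trans s0.
    by rewrite lerN10.
  - apply: continuous_in_subspaceT => u; rewrite inE /= in_itv /= => /andP[su _].
    have /F_derive : - 1 < u by rewrite (lt_le_trans _ su) // (lt_le_trans _ s0) // ltrN10.
    by move=> /(_ f fc) []; move/derivable1_diffP/differentiable_continuous.
  - move=> u _ _.
    have : is_derive u 1 id (1 : R) by apply: is_derive_id.
    by move=> /(is_deriveZ M); rewrite /GRing.scale /= mulr1.
  - by apply: continuous_subspaceT => u; apply: cvgM; [apply: cvg_cst|apply: cvg_id].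
have key2 s t : `|antid f t - antid f s| <= M * `|Num.max t 0 - Num.max s 0|.
  rewrite /antid opprB addrA subrK -!/(F f _).
  wlog st : s t / Num.max s 0 <= Num.max t 0.
    move=> wl; have [/wl//|/ltW/wl] := leP (Num.max s 0) (Num.max t 0).
    by rewrite distrC [`|_ - Num.max t 0|]distrC.
  have := key _ _ _ st; rewrite le_max lexx orbT => /(_ isT).
  by rewrite [X in _ -> _ <= _ * X]ger0_norm ?subr_ge0 // mulrBr.
move=> s t; apply: le_trans (key2 _ _) _; apply: ler_wpM2l => //.
exact: norm_max_le.
Qed.

Lemma antid_le0 f t : t <= 0 -> antid f t = 0.
Proof. by move=> t0; rewrite /antid max_r // subrr. Qed.

Lemma is_derive_affine_expR (C L t : R) :
  is_derive t (1 : R^o) (fun s => C * expR (L * s)) (L * (C * expR (L * t))).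
Proof.
have h1 : is_derive t (1 : R^o) (fun s : R => L * s) L.
  have : is_derive t 1 id (1 : R) by apply: is_derive_id.
  by move=> /(is_deriveZ L); rewrite /GRing.scale /= mulr1.
have h2 := is_derive1_comp (is_derive_expR (L * t)) h1.
have := is_deriveZ C h2; rewrite /GRing.scale /= /comp.
by rewrite [expR _ * L]mulrC mulrCA.
Qed.

(** Gronwall: g(s) exp(alpha s) has nonpositive derivative. *)
Lemma exp_decay g dg (alpha t : R) : 0 <= t ->
  (forall s : R, 0 < s -> s < t -> is_derive s (1 : R^o) g (dg s)) ->
  {within `[0, t], continuous g} ->
  (forall s : R, 0 < s -> s < t -> dg s <= - (alpha * g s)) ->
  g t * expR (alpha * t) <= g 0.
Proof.
move=> t0 hd hc hle.
pose f s := g s * (1 * expR (alpha * s)).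
pose df s := g s * (alpha * (1 * expR (alpha * s))) + (1 * expR (alpha * s)) * dg s.
have f0 : f 0 = g 0 by rewrite /f mulr0 expR0 !mulr1.
have ft : f t = g t * expR (alpha * t) by rewrite /f mul1r.
rewrite -f0 -ft; apply: (@derive_le0_le f df 0 t t0).
- by move=> s s0 st; exact: (is_deriveM (hd s s0 st) (is_derive_affine_expR 1 alpha s)).
- have c2 : {within `[0, t], continuous (fun s => 1 * expR (alpha * s))}.
    apply: continuous_subspaceT => s.
    by have [/derivable1_diffP/differentiable_continuous + _] := is_derive_affine_expR 1 alpha s.
  by move=> s; apply: cvgM; [exact: hc|exact: c2].
- move=> s s0 st; rewrite /df !mul1r.
  have -> : g s * (alpha * expR (alpha * s)) + expR (alpha * s) * dg s
    = expR (alpha * s) * (alpha * g s + dg s) by ring.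
  by have := hle s s0 st; have := expR_ge0 (alpha * s); nra.
Qed.

Lemma geo_le (a b C : R) : (forall n, a <= b + C / 2 ^+ n) -> a <= b.
Proof.
move=> h; rewrite -subr_le0.
apply: (@cvg0_le _ (fun n => C * 2^-1 ^+ n)).
  by apply: cvg_scale0; apply: cvg_expr; rewrite ger0_norm ?invr_ge0 // invf_lt1 ?ltr1n.
by move=> n; rewrite exprVn lerBlDl.
Qed.

(** The numbers a n - 2 E / 2^n increase and a n + 2 E / 2^n decrease; the supremum of the former
    lies between both and comes with the explicit rate. *)
Lemma geo_lim (a : nat -> R) E : (forall n, `|a n.+1 - a n| <= E / 2 ^+ n) ->
  exists l, forall n, `|a n - l| <= 2 * E / 2 ^+ n.
Proof.
move=> h; pose b n := a n - 2 * E / 2 ^+ n.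
have half n : E / 2 ^+ n = 2 * E / 2 ^+ n.+1.
  by rewrite exprS invfM mulrACA mulfV ?mul1r.
have double n : 2 * E / 2 ^+ n = E / 2 ^+ n + E / 2 ^+ n.
  by rewrite -mulrA mulr_natl mulr2n.
have E0 n : 0 <= E / 2 ^+ n by apply: le_trans (h n).
have bS n : b n <= b n.+1.
  have := h n; rewrite /b ler_norml => /andP[h1 _].
  have := half n; have := double n; lra.
have cS n : a n.+1 + 2 * E / 2 ^+ n.+1 <= a n + 2 * E / 2 ^+ n.
  have := h n; rewrite ler_norml => /andP[_ h1].
  have := half n; have := double n; lra.
have bm : {homo b : m n / (m <= n)%N >-> m <= n} by apply: homo_leq => //; exact: le_trans.
have cm m n : (m <= n)%N -> a n + 2 * E / 2 ^+ n <= a m + 2 * E / 2 ^+ m.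
  elim: n => [|n IH]; first by rewrite leqn0 => /eqP ->.
  by rewrite leq_eqVlt => /predU1P[->//|]; rewrite ltnS => /IH; apply: le_trans.
have bc m n : b m <= a n + 2 * E / 2 ^+ n.
  apply: le_trans (bm _ _ (leq_maxl m n)) _; apply: le_trans (cm _ _ (leq_maxr m n)).
  rewrite /b lerBlDr -addrA lerDl; have := E0 (maxn m n); rewrite -!mulrA; lra.
exists (sup (range b)) => n; rewrite ler_norml; apply/andP; split.
  suff : sup (range b) <= a n + 2 * E / 2 ^+ n by lra.
  by apply: ge_sup; [exists (b 0), 0|move=> _ [m _ <-]].
suff : b n <= sup (range b) by rewrite /b; lra.
apply: ub_le_sup; last by exists n.
by exists (a 0 + 2 * E / 2 ^+ 0) => _ [m _ <-].
Qed.

End Antiderivative.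

Section Picard.
Variables (R : realType) (I : Type) (F : (I -> R) -> I -> R) (M L : R) (x0 : I -> R).
Hypotheses (M0 : 0 <= M) (L0 : 0 < L) (FM : forall x i, `|F x i| <= M).
Hypothesis FL : forall x y (e : R), (forall i, `|x i - y i| <= e) ->
  forall i, `|F x i - F y i| <= L * e.

Fixpoint picard n : R -> I -> R :=
  if n is n'.+1 then fun t i => x0 i + antid (fun s => F (picard n' s) i) t
  else fun _ => x0.

Definition lip (u : R -> I -> R) := forall i, lipschitz_time M (u ^~ i).

Lemma lip_cont u i : lip u -> continuous (fun s => F (u s) i).
Proof.
move=> h; apply: (@lipschitz_time_continuous _ (L * M)) => s t.
by rewrite -mulrA; apply: FL => j; apply: h.
Qed.

Definition step (u : R -> I -> R) (t : R) i := x0 i + antid (fun s => F (u s) i) t.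

Lemma lip_step u : lip u -> lip (step u).
Proof.
move=> h i s t; rewrite /step opprD addrACA subrr add0r.
by apply: antid_lipschitz => //; apply: lip_cont.
Qed.

Lemma step_derive u i (t : R) : lip u -> 0 < t ->
  is_derive t (1 : R^o) (fun s => step u s i) (F (u t) i).
Proof.
move=> h t0; have := antid_derive (@lip_cont u i h) t0 => d1.
have d2 : is_derive t (1 : R^o) (cst (x0 i)) 0 by apply: is_derive_cst.
by have := is_deriveD d2 d1; rewrite add0r.
Qed.

Lemma step_le0 u i (t : R) : t <= 0 -> step u t i = x0 i.
Proof. by move=> t0; rewrite /step antid_le0 // addr0. Qed.

Lemma lip_picard n : lip (picard n).
Proof.
elim: n => [i s t|n IH]; last exact: lip_step.
by rewrite subrr normr0 mulr_ge0.
Qed.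

(** An exponential weight of rate 2 L makes the Picard step halve distances on the whole half-line
    at once, with no restriction to short times. The factor M / (2 L) lets E bound the first step: M
    t <= M / (2 L) (1 + 2 L t) <= E t. *)
Let E (t : R) := M / (2 * L) * expR (2 * L * t).

Let E_ge0 t : 0 <= E t.
Proof. by rewrite /E mulr_ge0 ?expR_ge0 // divr_ge0 // mulr_ge0 // ltW. Qed.

(** The integrands differ by at most L (2 C E), which is exactly the derivative of C E. *)
Lemma step_close u v (C : R) : 0 <= C -> lip u -> lip v ->
  (forall t i, `|u t i - v t i| <= 2 * C * E t) ->
  forall t i, `|step u t i - step v t i| <= C * E t.
Proof.
move=> C0 hu hv h t i.
have [t0|/ltW t0] := leP t 0.
  by rewrite !step_le0 // subrr normr0 mulr_ge0.
have := @derive_norm_le R (fun s => step u s i - step v s i)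
  (fun s => F (u s) i - F (v s) i)
  (fun s => C * (M / (2 * L)) * expR (2 * L * s))
  (fun s => 2 * L * (C * (M / (2 * L)) * expR (2 * L * s))) 0 t t0.
rewrite !(@step_le0 _ _ 0) // subrr subr0 mulr0 expR0 mulr1 => h1.
apply: le_trans (h1 _ _ _ _ _) _.
- move=> s s0 _; have := step_derive i hu s0; have := step_derive i hv s0 => d1 d2.
  exact: is_deriveB.
- apply: continuous_subspaceT => s; apply: cvgB.
    exact: (@lipschitz_time_continuous _ M _ (lip_step hu i) s).
  exact: (@lipschitz_time_continuous _ M _ (lip_step hv i) s).
- by move=> s _ _; apply: is_derive_affine_expR.
- apply: continuous_subspaceT => s.
  have [/derivable1_diffP/differentiable_continuous + _] :=
    is_derive_affine_expR (C * (M / (2 * L))) (2 * L) s.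
  by [].
- move=> s _ _; apply: le_trans (FL (h s) i) _; rewrite /E.
  by rewrite le_eqVlt; apply/orP; left; apply/eqP; ring.
by rewrite /E [C * (_ * expR _)]mulrA lerBlDr lerDl mulr_ge0 // divr_ge0 // mulr_ge0 // ltW.
Qed.

Lemma picard_close n t i : `|picard n.+1 t i - picard n t i| <= E t / 2 ^+ n.
Proof.
elim: n t i => [|n IH] t i.
  have -> : picard 1 t i = step (picard 0) t i by [].
  rewrite expr0 divr1.
  have [t0|t0] := leP t 0; first by rewrite step_le0 // subrr normr0.
  rewrite /step addrC addKr.
  have := antid_lipschitz (@lip_cont _ i (lip_picard 0)) (fun t => FM _ i) t 0.
  rewrite antid0 !subr0 => /le_trans; apply; rewrite gtr0_norm // /E.
  have L2 : 0 < 2 * L by rewrite mulr_gt0.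
  rewrite -mulrA ler_wpM2l // ler_pdivlMl //.
  by apply: le_trans (expR_ge1Dx _); rewrite lerDr.
rewrite mulrC; apply: (@step_close (picard n.+1) (picard n) _ _ (lip_picard _) (lip_picard _)).
  by rewrite invr_ge0 exprn_ge0.
move=> s j; apply: le_trans (IH s j) _; rewrite mulrC ler_wpM2r //.
by rewrite exprS invfM mulVKf.
Qed.

Theorem picard_lindelof : exists u : R -> I -> R,
  [/\ forall i, u 0 i = x0 i, lip u
    & forall (t : R) i, 0 < t -> is_derive t (1 : R^o) (fun s => u s i) (F (u t) i)].
Proof.
pose lim t i := cid (geo_lim (fun n => picard_close n t i)).
pose u t i := projT1 (lim t i).
have hu n t i : `|picard n t i - u t i| <= 2 * E t / 2 ^+ n by exact: (projT2 (lim t i)).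
have lu : lip u.
  move=> i s t; apply: (@geo_le _ _ _ (2 * E s + 2 * E t)) => n.
  have h1 := hu n s i; have h2 := hu n t i; have h3 := lip_picard n i s t.
  rewrite distrC in h1.
  have -> : u s i - u t i = (u s i - picard n s i) + (picard n s i - picard n t i)
      + (picard n t i - u t i) by ring.
  apply: le_trans (ler_normD _ _) _; apply: le_trans (lerD (ler_normD _ _) (lexx _)) _.
  by rewrite mulrDl; lra.
(* Both sides lie within a multiple of 2^-n of the iterate n + 1. *)
have e t : u t = step u t.
  apply/funext => i; apply/eqP; rewrite -subr_eq0 -normr_le0.
  apply: (@geo_le _ _ _ (2 * E t)) => n; rewrite add0r.
  have h1 : `|step (picard n) t i - step u t i| <= (2 ^+ n)^-1 * E t.
    apply: (@step_close (picard n) u _ _ (lip_picard _) lu); first by rewrite invr_ge0 exprn_ge0.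
    by move=> s j; apply: le_trans (hu n s j) _; rewrite mulrAC.
  have h2 := hu n.+1 t i; rewrite distrC in h2.
  have -> : u t i - step u t i = (u t i - picard n.+1 t i)
     + (step (picard n) t i - step u t i) by rewrite addrA subrK.
  apply: le_trans (ler_normD _ _) _; apply: le_trans (lerD h2 h1) _.
  have -> : 2 * E t / 2 ^+ n.+1 = (2 ^+ n)^-1 * E t.
    by rewrite exprS invfM mulrACA mulfV // mul1r mulrC.
  by rewrite le_eqVlt; apply/orP; left; apply/eqP; ring.
exists u; split => // [i|t i t0]; first by rewrite e step_le0.
rewrite (_ : (fun s => u s i) = fun s => step u s i); first exact: step_derive.
by apply/funext => s; rewrite {1}e.
Qed.

End Picard.

(** * Bounded and Lipschitz families *)

(* Families indexed by pairs of gains at distance [e]: [bd] reads O(1) and [sm]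
   reads O(e), on the domain [D]. *)
Section Bounds.
Variables (R : realType) (J : Type) (D : J -> Prop) (e : J -> R).
Hypotheses (e0 : forall j, 0 <= e j) (e1 : forall j, D j -> e j <= 1).

Definition bd m n (f : J -> 'M[R]_(m, n)) :=
  exists M, forall j, D j -> nrm (f j) <= M.

Definition sm m n (f : J -> 'M[R]_(m, n)) :=
  exists M, forall j, D j -> nrm (f j) <= M * e j.

Lemma bd_ge0 m n (f : J -> 'M[R]_(m, n)) : bd f ->
  exists2 M, 0 <= M & forall j, D j -> nrm (f j) <= M.
Proof.
case=> M h; exists `|M| => // j Dj; exact: le_trans (h j Dj) (ler_norm _).
Qed.

Lemma sm_ge0 m n (f : J -> 'M[R]_(m, n)) : sm f ->
  exists2 M, 0 <= M & forall j, D j -> nrm (f j) <= M * e j.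
Proof.
case=> M h; exists `|M| => // j Dj; apply: le_trans (h j Dj) _.
by rewrite ler_wpM2r // ler_norm.
Qed.

Lemma bd_cst m n (A : 'M[R]_(m, n)) : bd (fun=> A).
Proof. by exists (nrm A). Qed.

Lemma sm_bd m n (f : J -> 'M[R]_(m, n)) : sm f -> bd f.
Proof.
case/sm_ge0 => M M0 h; exists M => j Dj; apply: le_trans (h j Dj) _.
by rewrite ler_piMr // e1.
Qed.

Lemma bdD m n (f g : J -> 'M[R]_(m, n)) : bd f -> bd g -> bd (fun j => f j + g j).
Proof.
move=> [M h] [N k]; exists (M + N) => j Dj; apply: le_trans (nrmD _ _) _.
by rewrite lerD ?h ?k.
Qed.

Lemma smD m n (f g : J -> 'M[R]_(m, n)) : sm f -> sm g -> sm (fun j => f j + g j).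
Proof.
move=> [M h] [N k]; exists (M + N) => j Dj; apply: le_trans (nrmD _ _) _.
by rewrite mulrDl lerD ?h ?k.
Qed.

Lemma bdN m n (f : J -> 'M[R]_(m, n)) : bd f -> bd (fun j => - f j).
Proof. by move=> [M h]; exists M => j Dj; rewrite nrmN h. Qed.

Lemma smN m n (f : J -> 'M[R]_(m, n)) : sm f -> sm (fun j => - f j).
Proof. by move=> [M h]; exists M => j Dj; rewrite nrmN h. Qed.

Lemma bdT m n (f : J -> 'M[R]_(m, n)) : bd f -> bd (fun j => (f j)^T).
Proof. by move=> [M h]; exists M => j Dj; rewrite nrmT h. Qed.

Lemma smT m n (f : J -> 'M[R]_(m, n)) : sm f -> sm (fun j => (f j)^T).
Proof. by move=> [M h]; exists M => j Dj; rewrite nrmT h. Qed.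

Lemma bdM l m n (f : J -> 'M[R]_(l, m)) (g : J -> 'M[R]_(m, n)) :
  bd f -> bd g -> bd (fun j => f j *m g j).
Proof.
move=> /bd_ge0[M M0 h] [N k]; exists (M * N) => j Dj; apply: le_trans (nrmM _ _) _.
by rewrite ler_pM ?nrm_ge0 ?h ?k.
Qed.

Lemma smMl l m n (f : J -> 'M[R]_(l, m)) (g : J -> 'M[R]_(m, n)) :
  sm f -> bd g -> sm (fun j => f j *m g j).
Proof.
move=> /sm_ge0[M M0 h] [N k]; exists (M * N) => j Dj; apply: le_trans (nrmM _ _) _.
by rewrite mulrAC ler_pM ?nrm_ge0 ?h ?k.
Qed.

Lemma smMr l m n (f : J -> 'M[R]_(l, m)) (g : J -> 'M[R]_(m, n)) :
  bd f -> sm g -> sm (fun j => f j *m g j).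
Proof.
move=> /bd_ge0[M M0 h] [N k]; exists (M * N) => j Dj; apply: le_trans (nrmM _ _) _.
by rewrite -mulrA ler_pM ?nrm_ge0 ?h ?k.
Qed.

Lemma bdZ m n a (f : J -> 'M[R]_(m, n)) : bd f -> bd (fun j => a *: f j).
Proof. by move=> [M h]; exists (`|a| * M) => j Dj; rewrite nrmZ ler_wpM2l ?h. Qed.

Lemma smZ m n a (f : J -> 'M[R]_(m, n)) : sm f -> sm (fun j => a *: f j).
Proof.
by move=> [M h]; exists (`|a| * M) => j Dj; rewrite nrmZ -mulrA ler_wpM2l ?h.
Qed.

Lemma bd_sum (I : finType) m n (f : I -> J -> 'M[R]_(m, n)) :
  (forall i, bd (f i)) -> bd (fun j => \sum_i f i j).
Proof.
move=> h; elim: (index_enum I) => [|i s IH].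
  by exists 0 => j _; rewrite big_nil nrm0.
have [M hM] := bdD (h i) IH; exists M => j Dj; rewrite big_cons; exact: hM.
Qed.

Lemma sm_sum (I : finType) m n (f : I -> J -> 'M[R]_(m, n)) :
  (forall i, sm (f i)) -> sm (fun j => \sum_i f i j).
Proof.
move=> h; elim: (index_enum I) => [|i s IH].
  by exists 0 => j _; rewrite big_nil nrm0 mul0r.
have [M hM] := smD (h i) IH; exists M => j Dj; rewrite big_cons; exact: hM.
Qed.

Lemma smM2 l m n (f : J -> 'M[R]_(l, m)) (g : J -> 'M[R]_(m, n)) :
  sm f -> sm g -> exists M, forall j, D j -> nrm (f j *m g j) <= M * e j ^+ 2.
Proof.
move=> /sm_ge0[M M0 h] [N k]; exists (M * N) => j Dj; apply: le_trans (nrmM _ _) _.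
by rewrite expr2 mulrACA ler_pM ?nrm_ge0 ?h ?k.
Qed.

Lemma bd_unif (I : finType) m n (f : I -> J -> 'M[R]_(m, n)) :
  (forall i, bd (f i)) -> exists2 M, 0 <= M & forall i j, D j -> nrm (f i j) <= M.
Proof.
move=> h; have /choice[F hF] i : exists M, 0 <= M /\ forall j, D j -> nrm (f i j) <= M.
  by have [M M0 hM] := bd_ge0 (h i); exists M.
have F0 i : 0 <= F i by case: (hF i).
exists (\sum_i F i); first exact: sumr_ge0.
move=> i j Dj; have [_ /(_ j Dj)/le_trans] := hF i; apply.
by rewrite (bigD1 i) //= lerDl sumr_ge0.
Qed.

Lemma sm_unif (I : finType) m n (f : I -> J -> 'M[R]_(m, n)) :
  (forall i, sm (f i)) -> exists2 M, 0 <= M & forall i j, D j -> nrm (f i j) <= M * e j.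
Proof.
move=> h; have /choice[F hF] i : exists M, 0 <= M /\ forall j, D j -> nrm (f i j) <= M * e j.
  by have [M M0 hM] := sm_ge0 (h i); exists M.
have F0 i : 0 <= F i by case: (hF i).
exists (\sum_i F i); first exact: sumr_ge0.
move=> i j Dj; have [_ /(_ j Dj)/le_trans] := hF i; apply.
by rewrite ler_wpM2r // (bigD1 i) //= lerDl sumr_ge0.
Qed.

End Bounds.

(* Maps that are bounded and Lipschitz along the pairs of [D], [e] measuring
   the distance of a pair. *)
Section LipschitzPairs.
Variables (R : realType) (U : Type) (D : U * U -> Prop) (e : U * U -> R).
Hypothesis e0 : forall j, 0 <= e j.

Definition blip m n (f : U -> 'M[R]_(m, n)) :=
  [/\ bd D (fun j => f j.1), bd D (fun j => f j.2)
    & sm D e (fun j => f j.2 - f j.1)].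

Lemma blip_cst m n (A : 'M[R]_(m, n)) : blip (fun=> A).
Proof.
split; try exact: bd_cst.
by exists 0 => j _; rewrite subrr nrm0 mul0r.
Qed.

Lemma blipD m n (f g : U -> 'M[R]_(m, n)) :
  blip f -> blip g -> blip (fun x => f x + g x).
Proof.
move=> [f1 f2 fs] [g1 g2 gs]; split; try exact: bdD.
have [M h] := smD fs gs; exists M => j Dj.
by rewrite opprD addrACA h.
Qed.

Lemma blipZ m n a (f : U -> 'M[R]_(m, n)) : blip f -> blip (fun x => a *: f x).
Proof.
move=> [f1 f2 fs]; split; try exact: bdZ.
by have [M h] := smZ a fs; exists M => j Dj; rewrite -scalerBr h.
Qed.

Lemma blipN m n (f : U -> 'M[R]_(m, n)) : blip f -> blip (fun x => - f x).
Proof.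
move=> [f1 f2 fs]; split; try exact: bdN.
by have [M h] := smN fs; exists M => j Dj; rewrite -opprD h.
Qed.

Lemma blipB m n (f g : U -> 'M[R]_(m, n)) :
  blip f -> blip g -> blip (fun x => f x - g x).
Proof. by move=> hf hg; apply: blipD => //; apply: blipN. Qed.

Lemma blipM l m n (f : U -> 'M[R]_(l, m)) (g : U -> 'M[R]_(m, n)) :
  blip f -> blip g -> blip (fun x => f x *m g x).
Proof.
move=> [f1 f2 fs] [g1 g2 gs]; split; try exact: bdM.
have [M h] := smD (smMl e0 fs g2) (smMr f1 gs); exists M => j Dj.
by have := h j Dj; rewrite mulmxBl mulmxBr addrA subrK.
Qed.

Lemma blip_sum (I : finType) m n (f : I -> U -> 'M[R]_(m, n)) :
  (forall i, blip (f i)) -> blip (fun x => \sum_i f i x).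
Proof.
move=> h; split; try by apply: bd_sum => i; case: (h i).
have [M hM] : sm D e (fun j => \sum_i (f i j.2 - f i j.1)).
  by apply: sm_sum => i; case: (h i).
by exists M => j Dj; rewrite -sumrB hM.
Qed.

(** The resolvent identity: S_2^-1 - S_1^-1 = - S_2^-1 (S_2 - S_1) S_1^-1. *)
Lemma blip_inv n (S : U -> 'M[R]_n) mu : 0 < mu ->
  (forall j, D j -> posdef (S j.1 - mu%:M) /\ posdef (S j.2 - mu%:M)) ->
  blip S -> blip (fun x => invmx (S x)).
Proof.
move=> mu0 h [S1 S2 Ss].
have i1 : bd D (fun j => invmx (S j.1)).
  by exists ((n * n)%:R * (n%:R * mu^-1)) => j /h[hj _]; exact: nrm_inv.
have i2 : bd D (fun j => invmx (S j.2)).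
  by exists ((n * n)%:R * (n%:R * mu^-1)) => j /h[_ hj]; exact: nrm_inv.
split=> //.
have [M hM] := smN (smMl e0 (smMr i2 Ss) i1); exists M => j Dj.
have [/(gap_posdef mu0)/posdef_unit u1 /(gap_posdef mu0)/posdef_unit u2] := h j Dj.
have := hM j Dj; rewrite mulmxBr mulmxBl mulVmx // mul1mx -mulmxA mulmxV // mulmx1.
by rewrite opprB.
Qed.

End LipschitzPairs.

(** * Norms on gains *)

Section GainNorm.
Variables (R : realType) (Ns d k : nat).
Notation gainT := ('I_Ns -> 'M[R]_(k, d)).
Implicit Types V W : gainT.

(** Companion of [nrm] for the perturbation estimates; [gnrm_le_tnorm] converts from the Euclidean
    norm of the statement. *)
Definition gnrm V : R := \sum_i nrm (V i).

Lemma gnrm_ge0 V : 0 <= gnrm V.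
Proof. by apply: sumr_ge0 => i _; exact: nrm_ge0. Qed.

Lemma nrm_gnrm V i : nrm (V i) <= gnrm V.
Proof.
by rewrite /gnrm (bigD1 i) //= lerDl sumr_ge0 // => j _; exact: nrm_ge0.
Qed.

Lemma gnrm_le V e : (forall i a b, `|V i a b| <= e) -> gnrm V <= (Ns * (k * d))%:R * e.
Proof.
move=> h; apply: le_trans (_ : \sum_(i < Ns) (k * d)%:R * e <= _).
  by apply: ler_sum => i _; apply: nrm_le.
by rewrite sumr_const card_ord -mulrnAl -mulrnA [(_ * Ns)%N]mulnC.
Qed.

Lemma tnorm_sqr V : tnorm V ^+ 2 = tinner V V.
Proof. by rewrite sqr_sqrtr // sumr_ge0 // => i _; exact: sq_ge0. Qed.

Lemma entry_tnorm V i a b : `|V i a b| <= tnorm V.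
Proof.
rewrite -ler_sqr ?nnegrE ?sqrtr_ge0 // tnorm_sqr real_normK ?num_real //.
apply: le_trans (sq_entry _ _ _) _; rewrite /tinner (bigD1 i) //= lerDl.
by apply: sumr_ge0 => j _; exact: sq_ge0.
Qed.

Lemma gnrm_le_tnorm : exists2 c : R, 0 < c & forall V, gnrm V <= c * tnorm V.
Proof.
exists ((Ns * (k * d))%:R + 1) => [|V]; first by rewrite ltr_wpDl.
apply: le_trans (gnrm_le (entry_tnorm V)) _.
by rewrite ler_wpM2r ?sqrtr_ge0 // lerDl.
Qed.

Lemma tnorm_eq0 V : tnorm V = 0 -> forall i, V i = 0.
Proof.
move=> h i; apply/matrixP => a b; have := entry_tnorm V i a b.
by rewrite h normr_le0 mxE => /eqP.
Qed.

Lemma tinnerZr V W s : tinner V (fun i => s *: W i) = s * tinner V W.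
Proof.
by rewrite /tinner mulr_sumr; apply: eq_bigr => i _; rewrite -scalemxAr linearZ.
Qed.

Lemma tinnerDl V V' W : tinner (fun i => V i + V' i) W = tinner V W + tinner V' W.
Proof.
by rewrite /tinner -big_split; apply: eq_bigr => i _; rewrite trmxD mulmxDl linearD.
Qed.

Lemma tnormN V s : tnorm (fun i => (- s) *: V i) = tnorm (fun i => s *: V i).
Proof.
congr Num.sqrt; apply: eq_bigr => i _.
by rewrite scaleNr trmxN mulNmx mulmxN opprK.
Qed.

Lemma tnormZ V s : 0 <= s -> tnorm (fun i => s *: V i) = s * tnorm V.
Proof.
move=> s0; rewrite /tnorm tinnerZr.
have -> : tinner (fun i => s *: V i) V = s * tinner V V.
  rewrite /tinner mulr_sumr; apply: eq_bigr => i _.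
  by rewrite linearZ /= -scalemxAl linearZ.
by rewrite mulrA -expr2 sqrtrM ?sqr_ge0 // sqrtr_sqr ger0_norm.
Qed.

(** Expand |L Y - lam L|^2 >= 0 and use tr(L Y L^T) >= lam |L|^2. *)
Lemma sq_mul_ge (L : 'M[R]_(k, d)) (Y : 'M[R]_d) lam : Y^T = Y -> 0 < lam ->
  posdef (Y - lam%:M) -> lam ^+ 2 * sq L <= sq (L *m Y).
Proof.
move=> sY l0 hY; have h1 := tr_conj_ge L^T hY; rewrite trmxK in h1.
have h2 := pos_tr_ge0 (pos_gram (L *m Y + (- lam) *: L)^T); rewrite trmxK in h2.
have e : sq L^T = sq L by rewrite /sq trmxK mxtrace_mulC.
have e1 : \tr (L *m Y *m (L *m Y)^T) = sq (L *m Y) by rewrite mxtrace_mulC.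
have e2 : \tr (L *m L^T) = sq L by rewrite mxtrace_mulC.
have e3 : \tr (L *m (L *m Y)^T) = \tr (L *m Y *m L^T) by rewrite trmx_mul sY mulmxA.
rewrite e in h1; rewrite trmxD trmxZ mulmxDl !mulmxDr -!scalemxAl -!scalemxAr in h2.
rewrite !(mxtraceD, mxtraceZ) e1 e2 e3 in h2.
rewrite expr2; have := ler_wpM2l (ltW l0) h1; lra.
Qed.

End GainNorm.

(** * Cost, gradient and flows *)

Section Control.
Variables (R : realType) (Ns d k : nat).
Variables (A : 'I_Ns -> 'M[R]_d) (B : 'I_Ns -> 'M[R]_(d, k))
  (p : 'I_Ns -> 'I_Ns -> R) (pi : 'I_Ns -> R) (Sigma0 : 'M[R]_d)
  (Q : 'I_Ns -> 'M[R]_d) (Rc : 'I_Ns -> 'M[R]_k).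
Hypotheses (hp : stochastic p) (hpi : init_distr pi) (hS : posdef Sigma0)
  (hQ : forall i, posdef (Q i)) (hR : forall i, posdef (Rc i)).
Notation gainT := ('I_Ns -> 'M[R]_(k, d)).
Notation tup := ('I_Ns -> 'M[R]_d).
Notation stab := (stabilizing A B p).
Notation L := (Lop A B p).
Notation T := (Top A B p).
Notation G := (Gam A B).
Implicit Types (K : gainT).

Let p_ge0 : forall i j, 0 <= p i j. Proof. by case: hp. Qed.
Let pT_ge0 : forall i j, 0 <= p j i. Proof. by case: hp. Qed.

Definition X0 : tup := fun i => pi i *: Sigma0.
Definition QK K : tup := fun i => Q i + (K i)^T *m Rc i *m K i.
Notation C := (costR A B p pi Sigma0 Q Rc).
Notation X := (XK A B p pi Sigma0).

Lemma X0_posdef i : posdef (X0 i).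
Proof. by apply: posdefZ => //; case: hpi. Qed.

Lemma QK_ge K i : (QK K i - Q i)^T = QK K i - Q i /\ pos (QK K i - Q i).
Proof.
rewrite /QK addrC addKr; split; last exact/pos_conj/posdef_pos.
by rewrite !trmx_mul trmxK mulmxA; have [-> _] := hR i.
Qed.

Lemma QK_posdef K i : posdef (QK K i).
Proof. by rewrite -(subrKC (Q i) (QK K i)); apply: posdefD => //; case: (QK_ge K i). Qed.

(** * The fixed points P^K and X^K *)

(** A choice among solutions, with 0 as default; for stabilizing K a solution exists and is unique
    ([is_PK_uniq]). *)
Definition PK K : tup :=
  if pselect (exists P, is_PK A B p Q Rc K P) is left h then projT1 (cid h) else fun=> 0.

Lemma is_PKE K P : is_PK A B p Q Rc K P <-> forall i, P i = L K P i + QK K i.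
Proof. by split => h i; have := h i; rewrite LopE addrC. Qed.

Lemma PK_fix K : stab K -> forall i, PK K i = L K (PK K) i + QK K i.
Proof.
move=> /(stabilizingP _ _ p_ge0) st; apply/is_PKE.
rewrite /PK; case: pselect => [h|[]]; first exact: (projT2 (cid h)).
by have [P hP] := Sta_solve (QK K) st; exists P; apply/is_PKE.
Qed.

Lemma is_PK_PK K : stab K -> is_PK A B p Q Rc K (PK K).
Proof. by move=> st; apply/is_PKE/PK_fix. Qed.

Lemma is_PK_uniq K P : stab K -> is_PK A B p Q Rc K P -> P = PK K.
Proof.
move=> sK /is_PKE hP; have /(stabilizingP _ _ p_ge0) st := sK.
exact: (Sta_uniq st hP (PK_fix sK)).
Qed.

Lemma PK_sym K i : stab K -> (PK K i)^T = PK K i.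
Proof.
move=> sK; have /(stabilizingP _ _ p_ge0) st := sK.
by apply: (Sta_sym st (PK_fix sK)) => j; case: (QK_posdef K j).
Qed.

Lemma PK_pos K i : stab K -> pos (PK K i).
Proof.
move=> sK; have /(stabilizingP _ _ p_ge0) st := sK.
by apply: (Sta_pos p_ge0 st (PK_fix sK)) => j; apply/posdef_pos/QK_posdef.
Qed.

(** The n-th partial sum equals Y - T^n Y, where Y solves the fixed point equation; its limit Y is
    therefore the tuple defined entrywise by [XK]. *)
Lemma XK_limit K : stab K -> (forall i, X K i = T K (X K) i + X0 i) /\
  forall i a b, (fun n => \sum_(t < n) Xt A B p pi Sigma0 K t i a b) @ \oo --> X K i a b.
Proof.
move=> /(stabilizingP _ _ p_ge0) /Sta_Top st.
have [Y hY] := Sta_solve X0 st.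
have hc i a b : (fun n => \sum_(t < n) Xt A B p pi Sigma0 K t i a b) @ \oo --> Y i a b.
  rewrite -[Y i a b]subr0.
  rewrite (_ : (fun n => _) = fun n => Y i a b - iter n (T K) Y i a b).
    by apply: cvgB; [apply: cvg_cst|apply: st].
  apply/funext => n; rewrite {1}(iter_fixpoint n hY i) addmxE addrC addKr summxE.
  by apply: eq_bigr => t _; rewrite XtE.
suff -> : X K = Y by [].
apply/funext => i; apply/matrixP => a b; rewrite mxE.
exact: (cvg_lim (@Rhausdorff R) (hc i a b)).
Qed.

Lemma XK_fix K : stab K -> forall i, X K i = T K (X K) i + X0 i.
Proof. by case/XK_limit. Qed.

Lemma XK_ge K i : stab K -> (X K i - X0 i)^T = X K i - X0 i /\ pos (X K i - X0 i).
Proof.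
move=> sK; have /(stabilizingP _ _ p_ge0) /Sta_Top st := sK.
have sX j : (X K j)^T = X K j.
  by apply: (Sta_sym st (XK_fix sK)) => l; case: (X0_posdef l).
split; first by rewrite linearB /= sX; case: (X0_posdef i) => ->.
rewrite {1}XK_fix // addrK; apply: Phi_pos => // j.
apply: (Sta_pos pT_ge0 st (XK_fix sK)) => l; exact/posdef_pos/X0_posdef.
Qed.

Lemma XK_gap K i lam : stab K -> posdef (X0 i - lam%:M) -> posdef (X K i - lam%:M).
Proof.
move=> sK h; have [s q] := XK_ge i sK.
have -> : X K i - lam%:M = (X0 i - lam%:M) + (X K i - X0 i) by rewrite [RHS]addrC addrA subrK.
exact: posdefD.
Qed.

Lemma XK_posdef K i : stab K -> posdef (X K i).
Proof.
move=> sK; have [s q] := XK_ge i sK; rewrite -(subrKC (X0 i) (X K i)).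
by apply: posdefD => //; exact: X0_posdef.
Qed.

Lemma costE K : stab K -> cost A B p pi Sigma0 Q Rc K = (ip (QK K) (X K))%:E.
Proof.
move=> sK; have [_ h] := XK_limit sK.
rewrite /cost; apply/cvg_lim => //.
rewrite (_ : (fun n => _) = fun n => (\sum_(t < n) stage_cost A B p pi Sigma0 Q Rc K t)%:E).
  apply: cvg_EFin; first exact: nearW.
  (* The partial cost is the limit minus the pairing of [QK] with the tail of the series of X^K. *)
  rewrite (_ : _ \o _ = fun n => ip (QK K) (X K) + -1 * ip (QK K)
     (fun i => X K i - \sum_(t < n) Xt A B p pi Sigma0 K t i)).
    rewrite -[X in _ --> X]addr0; apply: cvgD; first exact: cvg_cst.
    apply: cvg_scale0; apply: ip_cvg0 => i a b.
    rewrite -(subrr (X K i a b)).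
    rewrite (_ : (fun n => _) = fun n => X K i a b - \sum_(t < n) Xt A B p pi Sigma0 K t i a b).
      by apply: cvgB; [apply: cvg_cst|apply: h].
    by apply/funext => n; rewrite addmxE oppmxE summxE.
  apply/funext => n /=; rewrite mulN1r /ip -sumrB.
  under eq_bigr do rewrite stage_costE.
  rewrite /ip exchange_big; apply: eq_bigr => i _ /=.
  rewrite -linearB /= -mulmxBr subKr mulmx_sumr linear_sum.
  by [].
by apply/funext => n; rewrite sumEFin big_mkord.
Qed.

(** By adjointness both sides equal the pairing of V - L V with X^K. With V = P^K this turns the
    cost into <P^K, X(0)>. *)
Lemma ip_fix K V W : stab K -> (forall i, V i = L K V i + W i) ->
  ip V X0 = ip W (X K).
Proof.
move=> sK h.
have -> : ip W (X K) = ip V (X K) - ip (L K V) (X K).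
  rewrite /ip -sumrB; apply: eq_bigr => i _; rewrite -linearB -mulmxBl /=.
  by rewrite {1}h addrC addKr.
have -> : ip V X0 = ip V (X K) - ip V (T K (X K)).
  rewrite /ip -sumrB; apply: eq_bigr => i _; rewrite -linearB -mulmxBr /=.
  by rewrite {1}(XK_fix sK) addrC addKr.
by rewrite [ip (L K V) _]ipC -ip_dual [ip (T K _) V]ipC.
Qed.

Lemma costR_QK K : stab K -> C K = ip (QK K) (X K).
Proof. by move=> sK; rewrite /costR costE. Qed.

Lemma costR_PK K : stab K -> C K = ip (PK K) X0.
Proof. by move=> sK; rewrite costR_QK // -(ip_fix sK (PK_fix sK)). Qed.

(** * Comparison of two gains *)

Definition SK K i := Rc i + (B i)^T *m Eop p (PK K) i *m B i.
Definition LKK K i := LK A B p Rc K (PK K) i.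

Lemma Eop_sym V i : (forall i, (V i)^T = V i) -> (Eop p V i)^T = Eop p V i :> 'M[R]_d.
Proof.
move=> h; rewrite /Eop linear_sum; apply: eq_bigr => j _ /=.
by rewrite linearZ /= h.
Qed.

Lemma Eop_pos V i : (forall i, pos (V i)) -> pos (Eop p V i : 'M[R]_d).
Proof.
move=> h x; rewrite /Eop bf_summ sumr_ge0 // => j _; rewrite bfZm mulr_ge0 //.
exact: h.
Qed.

Lemma SK_ge K i : stab K -> (SK K i - Rc i)^T = SK K i - Rc i /\ pos (SK K i - Rc i).
Proof.
move=> sK; rewrite /SK addrC addKr; split.
  by rewrite !trmx_mul trmxK mulmxA Eop_sym // => j; rewrite PK_sym.
by apply: pos_conj; apply: Eop_pos => j; apply: PK_pos.
Qed.

Lemma SK_gap K i mu : stab K -> posdef (Rc i - mu%:M) -> posdef (SK K i - mu%:M).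
Proof.
move=> sK h; have [s q] := SK_ge i sK.
have -> : SK K i - mu%:M = (Rc i - mu%:M) + (SK K i - Rc i) by rewrite [RHS]addrC addrA subrK.
exact: posdefD.
Qed.

(* Bellman defect of P^K under the gain K + D *)
Definition defect K (D : gainT) i :=
  (D i)^T *m SK K i *m D i + ((D i)^T *m LKK K i + (LKK K i)^T *m D i).

Lemma Bellman_defect K K' i : stab K ->
  L K' (PK K) i + QK K' i = PK K i + defect K (fun i => K' i - K i) i.
Proof.
move=> sK; pose D := K' i - K i.
have eK' : K' i = K i + D by rewrite addrC subrK.
rewrite [in PK K i + _]PK_fix // !LopE /defect -/D /QK /LKK /LK /SK eK'.
have sE : (Eop p (PK K) i)^T = Eop p (PK K) i by apply: Eop_sym => j; apply: PK_sym.
have [sR _] := hR i.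
set E := Eop p (PK K) i in sE *.
have -> : Gam A B K' i = G K i - B i *m D by rewrite /Gam eK' mulmxDr opprD addrA.
(* Eliminating A leaves Gamma, K and D as the only independent terms, so the identity becomes a
   formal expansion. *)
have -> : A i = G K i + B i *m K i by rewrite subrK.
move: (G K i) (K i) D {eK'} => g x D.
rewrite !(trmxD, trmxN, trmx_mul, trmxK) sE sR.
rewrite !(mulmxDl, mulmxDr, mulNmx, mulmxN, mulmxA, opprD).
apply/matrixP => a b; rewrite !(addmxE, oppmxE); ring.
Qed.

(** P^{K'} - P^K solves the fixed point equation of K' with the defect as source, so [ip_fix] at K'
    applies; hence the weight X^{K'}. *)
Lemma cost_diff K K' : stab K -> stab K' ->
  C K' - C K = \sum_i \tr (X K' i *m defect K (fun i => K' i - K i) i).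
Proof.
move=> sK sK'; rewrite !costR_PK //.
have -> : ip (PK K') X0 - ip (PK K) X0 = ip (fun i => PK K' i - PK K i) X0.
  by rewrite /ip -sumrB; apply: eq_bigr => i _; rewrite mulmxBl linearB.
rewrite (ip_fix (W := defect K (fun i => K' i - K i)) sK').
  by rewrite ipC.
move=> i; have -> : L K' (fun i => PK K' i - PK K i) i = L K' (PK K') i - L K' (PK K) i.
  exact: PhiB.
rewrite {1}(PK_fix sK').
have := Bellman_defect K' i sK => /(canRL (addKr _)) ->.
move: (L K' (PK K') i) (L K' (PK K) i) (QK K' i) (PK K i) (defect _ _ i) => u v w z x.
by apply/matrixP => a b; rewrite !(addmxE, oppmxE); ring.
Qed.

Lemma tr_sym_cross n m (Y : 'M[R]_n) (D E : 'M[R]_(m, n)) : Y^T = Y ->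
  \tr (Y *m (D^T *m E + E^T *m D)) = 2 * \tr (Y *m (E^T *m D)).
Proof.
move=> sY; rewrite mulmxDr linearD /= mulr_natl mulr2n; congr (_ + _).
by rewrite -mxtrace_tr !trmx_mul trmxK sY mxtrace_mulC.
Qed.

Definition grad K : gainT := fun i => 2 *: (LKK K i *m X K i).

Lemma XK_sym K i : stab K -> (X K i)^T = X K i.
Proof. by move=> /XK_posdef => /(_ i)[]. Qed.

(** * Bounds on sublevel sets *)

Lemma sum_le_term (F : 'I_Ns -> R) c i : (forall i, 0 <= F i) -> \sum_i F i <= c -> F i <= c.
Proof.
by move=> h; apply: le_trans; rewrite (bigD1 i) //= lerDl sumr_ge0.
Qed.

Lemma costR_term K c i : stab K -> C K <= c -> \tr (X K i *m QK K i) <= c.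
Proof.
move=> sK; rewrite costR_QK // ipC => h; apply: sum_le_term h => j.
by apply: tr_pos; [exact: XK_posdef|exact/posdef_pos/QK_posdef].
Qed.

(** C(K) = <P^K, X(0)> dominates lam tr P_i, as X(0) >= lam. *)
Lemma PK_bound c : exists M, forall K i, stab K -> C K <= c -> nrm (PK K i) <= M.
Proof.
have [lam lam0 hlam] := posdef_gaps X0_posdef.
exists ((d * d)%:R * (c / lam)) => K i sK hc.
apply: le_trans (pos_nrm (PK_sym i sK) (PK_pos i sK)) _; rewrite ler_wpM2l //.
rewrite ler_pdivlMr // mulrC; apply: le_trans (tr_ge (hlam i) (PK_pos i sK)) _.
rewrite costR_PK // ipC in hc; apply: sum_le_term hc => j.
by apply: tr_pos; [exact: X0_posdef|exact: PK_pos].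
Qed.

(** C(K) = <Q + K^T R K, X^K> dominates q tr X_i, as Q >= q. *)
Lemma XK_bound c : exists M, forall K i, stab K -> C K <= c -> nrm (X K i) <= M.
Proof.
have [q q0 hq] := posdef_gaps hQ.
exists ((d * d)%:R * (c / q)) => K i sK hc.
have pX := posdef_pos (XK_posdef i sK).
apply: le_trans (pos_nrm (XK_sym i sK) pX) _; rewrite ler_wpM2l //.
rewrite ler_pdivlMr // mulrC; apply: le_trans (tr_ge (hq i) pX) _.
rewrite mxtrace_mulC; apply: le_trans (costR_term i sK hc).
rewrite -subr_ge0 -linearB /= -mulmxBr; apply: tr_pos; first exact: XK_posdef.
by case: (QK_ge K i).
Qed.

(** The control part tr(X_i K_i^T R_i K_i) of the cost dominates lam mu |K_i|^2. *)
Lemma K_bound c : exists M, forall K i, stab K -> C K <= c -> nrm (K i) <= M.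
Proof.
have [lam lam0 hlam] := posdef_gaps X0_posdef.
have [mu mu0 hmu] := posdef_gaps hR.
exists ((k * d)%:R * (1 + c / (lam * mu))) => K i sK hc.
apply: le_trans (nrm_sq _) _; rewrite ler_wpM2l // lerD2l.
rewrite ler_pdivlMr ?mulr_gt0 // mulrC -mulrA.
apply: le_trans (ler_wpM2l (ltW lam0) (tr_conj_ge (K i) (hmu i))) _.
apply: le_trans (costR_term i sK hc).
have pR : pos ((K i)^T *m Rc i *m K i) by apply/pos_conj/posdef_pos.
apply: le_trans (tr_ge (XK_gap sK (hlam i)) pR) _.
rewrite /QK mulmxDr linearD lerDr; apply: tr_pos; first exact: XK_posdef.
exact: posdef_pos.
Qed.

(** * Perturbation of a gain at a scale uniform on sublevel sets *)

(** Asymmetric on purpose: stability of the second gain is a conclusion ([near_stab]). *)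
Definition near_pair c del (j : gainT * gainT) :=
  [/\ stab j.1, C j.1 <= c & gnrm (fun i => j.2 i - j.1 i) <= del].

Definition gdist (j : gainT * gainT) := gnrm (fun i => j.2 i - j.1 i).

Lemma gdist_ge0 j : 0 <= gdist j. Proof. exact: gnrm_ge0. Qed.

Lemma sm_diff (D : gainT * gainT -> Prop) i : sm D gdist (fun j => j.2 i - j.1 i).
Proof.
exists 1 => j _; rewrite mul1r.
exact: (nrm_gnrm (fun i => j.2 i - j.1 i)).
Qed.

Lemma sm_defect c i : sm (near_pair c 1) gdist
  (fun j => defect j.1 (fun i => j.2 i - j.1 i) i).
Proof.
have e1 j : near_pair c 1 j -> gdist j <= 1 by case.
have hD := sm_diff (near_pair c 1) i; have bD := sm_bd gdist_ge0 e1 hD.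
have bP l : bd (near_pair c 1) (fun j => PK j.1 l).
  by have [M hM] := PK_bound c; exists M => j [s1 s2 _]; apply: hM.
have bE : bd (near_pair c 1) (fun j => Eop p (PK j.1) i).
  by apply: bd_sum => l; apply: bdZ.
have bK : bd (near_pair c 1) (fun j => j.1 i).
  by have [M hM] := K_bound c; exists M => j [s1 s2 _]; apply: hM.
have bS : bd (near_pair c 1) (fun j => SK j.1 i).
  by apply: bdD; [exact: bd_cst|apply: bdM; [apply: bdM|]] => //; exact: bd_cst.
have bL : bd (near_pair c 1) (fun j => LKK j.1 i).
  apply: bdD; first exact: bdM.
  by apply/bdN/bdM; [apply: bdM|] => //; exact: bd_cst.
apply: smD; first by apply: smMr => //; apply: bdM => //; exact: bdT.
by apply: smD; [apply: (smMl gdist_ge0) => //; exact: smT|apply: smMr => //; exact: bdT].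
Qed.

(** P^K serves as Lyapunov function for K': by [Bellman_defect], P^K - L_{K'} P^K = Q + K'^T R K' -
    defect, and a small defect leaves at least q / 2. *)
Lemma near_stab c : exists del, [/\ 0 < del, del <= 1 &
  forall j, near_pair c del j -> stab j.2 /\ C j.2 <= 2 * c].
Proof.
have [q q0 hq] := posdef_gaps hQ.
have [W W0 hW] := sm_unif gdist_ge0 (sm_defect c).
have W1 : 0 < 8 * (W + 1) by lra.
(* Gives W del <= q / 8, so the defect stays below q / 2 as a form and twice the defect below q; W +
   1 avoids dividing by 0. *)
pose del := Num.min 1 (q / (8 * (W + 1))).
have del1 : del <= 1 by rewrite /del ge_min lexx.
exists del; split=> //; first by rewrite /del lt_min ltr01 divr_gt0.
case=> K K' [/= sK hc hdel].
pose Df i := defect K (fun i => K' i - K i) i.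
have bW i x : `|bf (Df i) x x| <= q / 2 * bf 1%:M x x.
  have : nrm (Df i) <= W * del.
    apply: le_trans (hW i (K, K') _) _; first by split=> //=; exact: le_trans del1.
    by rewrite ler_wpM2l.
  have : W * del <= q / 8.
    apply: le_trans (_ : (W + 1) * del <= _).
      by rewrite ler_wpM2r ?lerDl // ltW // /del lt_min ltr01 divr_gt0.
    rewrite mulrC -ler_pdivlMr ?ltr_wpDl // /del ge_min; apply/orP; right.
    by rewrite invfM mulrA.
  have := bf_bound (Df i) x x; have := bf1_ge0 x; nra.
have QKq i x : q * bf 1%:M x x <= bf (QK K' i) x x.
  have := posdef_gap_bf x (hq i); have [_ /(_ x)] := QK_ge K' i.
  by rewrite bfBm; lra.
have fixK i : PK K i = L K' (PK K) i + (QK K' i - Df i).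
  by rewrite addrA Bellman_defect // addrK.
have st : Sta p (fun i _ => Gam A B K' i).
  apply: (Lyapunov_Sta p_ge0 (Z := PK K) (q := q / 2)); first by rewrite divr_gt0.
    by move=> i; exact: PK_pos.
  move=> i x.
  have -> : PK K i - Phi p (fun i _ => Gam A B K' i) (PK K) i = QK K' i - Df i.
    by rewrite {1}fixK addrC addKr.
  rewrite !bfBm bf_scalar; have := bW i x; have := QKq i x.
  by rewrite ler_norml => ? /andP[_]; lra.
have sK' : stab K' by apply/stabilizingP.
split=> //; apply: le_trans (_ : 2 * C K <= _); last by rewrite ler_pM2l.
rewrite !costR_PK // /ip mulr_sumr; apply: ler_sum => i _.
rewrite -linearZ -subr_ge0 -linearB /= scalemxAl -mulmxBl mxtrace_mulC.
apply: tr_pos; first exact: X0_posdef.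
have pos2 l : pos (QK K' l - 2 *: Df l).
  move=> x; rewrite bfBm bfZm; have := bW l x; have := QKq l x.
  by rewrite ler_norml => ? /andP[_]; lra.
(* 2 P^K - P^{K'} is the fixed point for K' with source [QK K'] - 2 defect >= 0; this yields C(K')
   <= 2 C(K). *)
apply: (Sta_pos p_ge0 st (V := fun i => 2 *: PK K i - PK K' i) _ pos2) => l.
rewrite PhiB PhiZ -![Phi _ _ _ l]/(L K' _ l) {1}fixK {1}(PK_fix sK').
move: (L K' (PK K) l) (L K' (PK K') l) (QK K' l) (Df l) => x y z t.
by apply/matrixP => a b; rewrite !(addmxE, oppmxE, mxE); ring.
Qed.

(** [fix_lip] for K' with the defect as source, measured against P^{K'}, which is bounded at level 2
    c. *)
Lemma near_PK c del : del <= 1 ->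
  (forall j, near_pair c del j -> stab j.2 /\ C j.2 <= 2 * c) ->
  forall i, sm (near_pair c del) gdist (fun j => PK j.2 i - PK j.1 i).
Proof.
move=> del1 hst i.
have [q q0 hq] := posdef_gaps hQ.
have [W W0 hW] := sm_unif gdist_ge0 (sm_defect c).
have [M hM] := PK_bound (2 * c).
exists ((d * d)%:R * (2 * (W / q) * M)) => -[K K'] hj; have [sK' hc'] := hst _ hj.
have [/= sK hc hdel] := hj; rewrite /= in sK' hc'.
have st : Sta p (fun i _ => Gam A B K' i) by apply/stabilizingP.
have := @fix_lip _ _ _ _ _ st (fun i => PK K' i - PK K i)
  (defect K (fun i => K' i - K i)) (PK K') (QK K') (W * gdist (K, K')) q p_ge0 q0 _ _ _ _ i.
rewrite -!mulrA => /(_ _ _ _ _)/le_trans; apply.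
- move=> l; rewrite PhiB -![Phi _ _ _ l]/(L K' _ l) {1}(PK_fix sK').
  have := Bellman_defect K' l sK => /(canRL (addKr _)) ->.
  move: (L K' (PK K') l) (L K' (PK K) l) (QK K' l) (PK K l) (defect _ _ l) => u v w z x.
  by apply/matrixP => a b; rewrite !(addmxE, oppmxE); ring.
- exact: PK_fix.
- by move=> l; apply: (hW l (K, K')); split=> //=; exact: le_trans del1.
- move=> l; have [s t] := QK_ge K' l.
  have -> : QK K' l - q%:M = (Q l - q%:M) + (QK K' l - Q l) by rewrite [RHS]addrC addrA subrK.
  exact: posdefD.
do 3! rewrite ler_wpM2l //.
rewrite mulrCA ler_wpM2l ?invr_ge0 ?(ltW q0) // mulrC.
by rewrite ler_wpM2r ?gdist_ge0 ?hM.
Qed.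

(** As for P^K, with source T_{K'} X^K - T_K X^K, measured against X^{K'}. *)
Lemma near_XK c del : del <= 1 ->
  (forall j, near_pair c del j -> stab j.2 /\ C j.2 <= 2 * c) ->
  forall i, sm (near_pair c del) gdist (fun j => X j.2 i - X j.1 i).
Proof.
move=> del1 hst i.
have e1 j : near_pair c del j -> gdist j <= 1 by case=> _ _ /le_trans; apply.
have [lam lam0 hlam] := posdef_gaps X0_posdef.
pose Z (j : gainT * gainT) i := T j.2 (X j.1) i - T j.1 (X j.1) i.
have smZ l : sm (near_pair c del) gdist (Z ^~ l).
  have bX m : bd (near_pair c del) (fun j => X j.1 m).
    by have [M hM] := XK_bound c; exists M => j [s1 s2 _]; apply: hM.
  have bG m : bd (near_pair c del) (fun j => G j.1 m).
    apply: bdD; first exact: bd_cst.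
    apply/bdN/bdM; first exact: bd_cst.
    by have [M hM] := K_bound c; exists M => j [s1 s2 _]; apply: hM.
  have bG' m : bd (near_pair c del) (fun j => G j.2 m).
    apply: bdD; first exact: bd_cst.
    apply/bdN/bdM; first exact: bd_cst.
    by have [M hM] := K_bound (2 * c); exists M => j /hst[s1 s2]; apply: hM.
  have sG m : sm (near_pair c del) gdist (fun j => G j.2 m - G j.1 m).
    have [M hM] := smN (smMr (bd_cst (near_pair c del) (B m)) (sm_diff (near_pair c del) m)).
    exists M => j Dj; have := hM j Dj; congr (nrm _ <= _).
    by rewrite mulmxBr /Gam !opprD !opprK addrACA subrr add0r.
  have : sm (near_pair c del) gdist (fun j => \sum_m p m l *:
      ((G j.2 m - G j.1 m) *m X j.1 m *m (G j.2 m)^T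
       + G j.1 m *m X j.1 m *m (G j.2 m - G j.1 m)^T)).
    apply: sm_sum => m; apply: smZ; apply: smD.
      by apply: (smMl gdist_ge0); [apply: (smMl gdist_ge0)|exact: bdT].
    by apply: smMr; [exact: bdM|exact: smT].
  case=> M hM; exists M => j Dj; have := hM j Dj; congr (nrm _ <= _).
  rewrite /Z !TopE -sumrB; apply: eq_bigr => m _; rewrite -scalerBr; congr (_ *: _).
  move: (G j.2 m) (G j.1 m) => g' g.
  by rewrite trmxB !mulmxBl mulmxBr addrA subrK.
have [W W0 hW] := sm_unif gdist_ge0 smZ.
have [M hM] := XK_bound (2 * c).
exists ((d * d)%:R * (2 * (W / lam) * M)) => -[K K'] hj; have [sK' hc'] := hst _ hj.
have [/= sK hc hdel] := hj; rewrite /= in sK' hc'.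
have /Sta_Top st : Sta p (fun i _ => Gam A B K' i) by apply/stabilizingP.
have := @fix_lip _ _ _ _ _ st (fun i => X K' i - X K i)
  (Z (K, K')) (X K') X0 (W * gdist (K, K')) lam pT_ge0 lam0 _ _ _ _ i.
rewrite -!mulrA => /(_ _ _ _ _)/le_trans; apply.
- move=> l; rewrite PhiB -![Phi _ _ _ l]/(T K' _ l) /Z {1}(XK_fix sK') {1}(XK_fix sK) /=.
  move: (T K' (X K') l) (T K' (X K) l) (T K (X K) l) (X0 l) => u v w z.
  by apply/matrixP => a b; rewrite !(addmxE, oppmxE); ring.
- exact: XK_fix.
- by move=> l; apply: hW.
- exact: hlam.
do 3! rewrite ler_wpM2l //.
rewrite mulrCA ler_wpM2l ?invr_ge0 ?(ltW lam0) // mulrC.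
by rewrite ler_wpM2r ?gdist_ge0 ?hM.
Qed.

Notation blips c del := (blip (near_pair c del) gdist).

Lemma near_blip c : exists del, [/\ 0 < del, del <= 1,
  forall j, near_pair c del j -> stab j.2 &
  forall i, [/\ blips c del (fun K => K i), blips c del (fun K => PK K i)
    & blips c del (fun K => X K i)]].
Proof.
have [del [del0 del1 hst]] := near_stab c.
exists del; split=> // [j /hst[]//|i]; split; split.
- by have [M hM] := K_bound c; exists M => j [s1 s2 _]; apply: hM.
- by have [M hM] := K_bound (2 * c); exists M => j /hst[s1 s2]; apply: hM.
- exact: sm_diff.
- by have [M hM] := PK_bound c; exists M => j [s1 s2 _]; apply: hM.
- by have [M hM] := PK_bound (2 * c); exists M => j /hst[s1 s2]; apply: hM.
- exact: near_PK.
- by have [M hM] := XK_bound c; exists M => j [s1 s2 _]; apply: hM.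
- by have [M hM] := XK_bound (2 * c); exists M => j /hst[s1 s2]; apply: hM.
- exact: near_XK.
Qed.

Lemma blip_SK D i : (forall l, blip D gdist (fun K => PK K l)) ->
  blip D gdist (fun K => SK K i).
Proof.
move=> hP; apply: blipD; first exact: blip_cst.
apply: (blipM gdist_ge0); last exact: blip_cst.
apply: (blipM gdist_ge0); first exact: blip_cst.
by apply: blip_sum => l; apply: blipZ.
Qed.

Lemma blip_LKK D i : (forall l, blip D gdist (fun K => PK K l)) ->
  blip D gdist (fun K => K i) -> blip D gdist (fun K => LKK K i).
Proof.
move=> hP hK; apply: blipB; first by apply: (blipM gdist_ge0) => //; exact: blip_SK.
apply: (blipM gdist_ge0); last exact: blip_cst.
apply: (blipM gdist_ge0); first exact: blip_cst.
by apply: blip_sum => l; apply: blipZ.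
Qed.

Lemma costR_lip c del : (forall l, blips c del (fun K => PK K l)) ->
  (forall j, near_pair c del j -> stab j.2) ->
  exists2 M, 0 <= M & forall j, near_pair c del j -> `|C j.2 - C j.1| <= M * gdist j.
Proof.
move=> hP hs.
have [_ _ /(sm_ge0 gdist_ge0)[M M0 hM]] : blips c del (fun K => \sum_i PK K i *m X0 i).
  by apply: blip_sum => i; apply: (blipM gdist_ge0) => //; exact: blip_cst.
exists M => // j Dj; apply: le_trans (hM j Dj); have [s1 _ _] := Dj.
rewrite !costR_PK //; last exact: hs.
rewrite /ip -!linear_sum -linearB; exact: nrm_tr.
Qed.

(** * Gradient of the cost *)

Lemma tinner_grad K V : stab K ->
  tinner (grad K) V = \sum_i \tr (X K i *m ((V i)^T *m LKK K i + (LKK K i)^T *m V i)).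
Proof.
move=> sK; apply: eq_bigr => i _; rewrite tr_sym_cross; last exact: XK_sym.
by rewrite /grad linearZ /= trmx_mul XK_sym // -scalemxAl linearZ /= mulmxA.
Qed.

(** In [cost_diff], the term quadratic in D and the replacement of X^{K'} by X^K in the linear term
    are both of second order. *)
Lemma grad_expansion K : stab K -> exists del M, [/\ 0 < del, 0 <= M &
  forall K', gnrm (fun i => K' i - K i) <= del -> stab K' /\
    `|C K' - C K - tinner (grad K) (fun i => K' i - K i)|
      <= M * gnrm (fun i => K' i - K i) ^+ 2].
Proof.
move=> sK; pose c := C K.
have [del [del0 del1 hst hb]] := near_blip c.
have hK i : blips c del (fun K => K i) by case: (hb i).
have hP i : blips c del (fun K => PK K i) by case: (hb i).
have hX i : blips c del (fun K => X K i) by case: (hb i).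
have sD i := sm_diff (near_pair c del) i.
have h1 i : exists M, forall j, near_pair c del j ->
    nrm ((X j.2 i *m (j.2 i - j.1 i)^T *m SK j.1 i) *m (j.2 i - j.1 i)) <= M * gdist j ^+ 2.
  apply: (smM2 gdist_ge0) => //; apply: (smMl gdist_ge0); last by case: (blip_SK i hP).
  by apply: smMr; [case: (hX i)|exact: smT].
have h2 i : exists M, forall j, near_pair c del j ->
    nrm ((X j.2 i - X j.1 i) *m ((j.2 i - j.1 i)^T *m LKK j.1 i
       + (LKK j.1 i)^T *m (j.2 i - j.1 i))) <= M * gdist j ^+ 2.
  have [bL _ _] := blip_LKK hP (hK i).
  apply: (smM2 gdist_ge0) => //; first by case: (hX i).
  apply: smD; first by apply: (smMl gdist_ge0) => //; exact: smT.
  by apply: smMr => //; exact: bdT.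
have [M1 hM1] := choice h1; have [M2 hM2] := choice h2.
exists del, `|\sum_i (M1 i + M2 i)|; split=> // K' hK'.
have Dj : near_pair c del (K, K') by split.
have sK' := hst _ Dj; split=> //.
apply: le_trans (_ : (\sum_i (M1 i + M2 i)) * gdist (K, K') ^+ 2 <= _); last first.
  by rewrite ler_wpM2r ?sqr_ge0 // ler_norm.
rewrite cost_diff // tinner_grad // -sumrB mulr_suml.
apply: le_trans (ler_norm_sum _ _ _) _; apply: ler_sum => i _.
rewrite -linearB /=; apply: le_trans (nrm_tr _) _; rewrite mulrDl.
apply: le_trans (lerD (hM1 i _ Dj) (hM2 i _ Dj)).
apply: le_trans (nrmD _ _); rewrite /defect mulmxDr !mulmxA mulmxBl.
by rewrite addrA.
Qed.

Lemma is_grad_grad K : stab K -> is_grad A B p pi Sigma0 Q Rc K (grad K).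
Proof.
move=> sK eps eps0; have [del [M [del0 M0 h]]] := grad_expansion sK.
have [c c0 hc] := gnrm_le_tnorm R Ns d k.
have M1 : 0 < M * c ^+ 2 + 1 by rewrite ltr_wpDl // mulr_ge0 // sqr_ge0.
exists (Num.min (del / c) (eps / (M * c ^+ 2 + 1))).
  by rewrite lt_min !divr_gt0.
move=> V; rewrite lt_min => /andP[]; rewrite !ltr_pdivlMr // => t1 t2.
have e : (fun i => K i + V i - K i) = V by apply/funext => i; rewrite addrC addKr.
have := h (fun i => K i + V i); rewrite e => -[|sK' h1].
  by apply: le_trans (hc V) _; rewrite mulrC ltW.
split=> //; apply: le_trans h1 _.
have g2 : gnrm V ^+ 2 <= (c * tnorm V) ^+ 2.
  by rewrite ler_sqr ?nnegrE ?gnrm_ge0 ?mulr_ge0 ?(ltW c0) ?sqrtr_ge0 // hc.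
apply: le_trans (ler_wpM2l M0 g2) _; rewrite exprMn [tnorm V ^+ 2]expr2 !mulrA.
rewrite ler_wpM2r ?sqrtr_ge0 // mulrC; apply: le_trans (ltW t2).
by rewrite ler_wpM2l ?sqrtr_ge0 // -mulrA -expr2 lerDl.
Qed.

(** Compare the two expansions along H = G1 - G2 at length m / 2: the linear parts differ by (m / 2)
    |H|, while the two errors add up to at most half of that. *)
Lemma is_grad_uniq K G1 G2 : is_grad A B p pi Sigma0 Q Rc K G1 ->
  is_grad A B p pi Sigma0 Q Rc K G2 -> G1 = G2.
Proof.
move=> h1 h2; apply/funext => i; apply/eqP; rewrite -subr_eq0; apply/eqP.
pose H : gainT := fun i => G1 i - G2 i; rewrite -/(H i); move: i.
apply: tnorm_eq0; apply/eqP; case: eqVneq => // H0; exfalso.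
have {}H0 : 0 < tnorm H by rewrite lt_def H0 sqrtr_ge0.
have e0 : 0 < tnorm H / 4 by rewrite divr_gt0.
have [d1 d10 hd1] := h1 _ e0; have [d2 d20 hd2] := h2 _ e0.
pose m := Num.min d1 d2; have m0 : 0 < m by rewrite lt_min d10.
pose s := m / 2 / tnorm H; have s0 : 0 < s by rewrite !divr_gt0.
have tV : tnorm (fun i => s *: H i) = m / 2.
  by rewrite tnormZ ?(ltW s0) // /s mulrVK // unitfE gt_eqF.
have lm : m / 2 < m by rewrite ltr_pdivrMr // mulr_natr mulr2n ltrDl.
have [|_] := hd1 (fun i => s *: H i).
  by rewrite tV (lt_le_trans lm) // ge_min lexx.
have [|_] := hd2 (fun i => s *: H i).
  by rewrite tV (lt_le_trans lm) // ge_min lexx orbT.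
rewrite tV; set a := costR _ _ _ _ _ _ _ _; set b := costR _ _ _ _ _ _ _ _.
have e : tinner G1 (fun i => s *: H i) = tinner G2 (fun i => s *: H i) + m / 2 * tnorm H.
  rewrite -tV tnormZ ?(ltW s0) // -mulrA -expr2 tnorm_sqr -tinnerZr.
  by rewrite -tinnerDl; congr (tinner _ _); apply/funext => i; rewrite /H addrC subrK.
rewrite e !ler_norml => /andP[k1 k2] /andP[k3 k4].
have : 0 < m / 2 * tnorm H by rewrite mulr_gt0 // divr_gt0.
lra.
Qed.

(** * Coercivity, gradient dominance and decay rates *)

Section Optimal.
Variable Ks : gainT.
Hypotheses (sKs : stab Ks) (minKs : forall K, stab K -> C Ks <= C K).

(** Otherwise a short step along - grad would lower the cost: the error is at most a quarter of the
    linear gain. *)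
Lemma grad_opt i : grad Ks i = 0.
Proof.
pose H := grad Ks; rewrite -/(H i); move: i.
apply: tnorm_eq0; apply/eqP; case: eqVneq => // H0; exfalso.
have {}H0 : 0 < tnorm H by rewrite lt_def H0 sqrtr_ge0.
have e0 : 0 < tnorm H / 4 by rewrite divr_gt0.
have [m m0 hm] := is_grad_grad sKs e0.
pose s := m / 2 / tnorm H; have s0 : 0 < s by rewrite !divr_gt0.
have tV : tnorm (fun i => (- s) *: H i) = m / 2.
  by rewrite tnormN tnormZ ?(ltW s0) // /s mulrVK // unitfE gt_eqF.
have lm : m / 2 < m by rewrite ltr_pdivrMr // mulr_natr mulr2n ltrDl.
have [|st] := hm (fun i => (- s) *: H i); first by rewrite tV.
have := minKs st; rewrite tV; set a := costR _ _ _ _ _ _ _ _; set b := costR _ _ _ _ _ _ _ _.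
have -> : tinner (grad Ks) (fun i => (- s) *: H i) = - (m / 2 * tnorm H).
  rewrite tinnerZr -/H -(tnorm_sqr H) -tV tnormN (tnormZ H (ltW s0)).
  by rewrite mulNr expr2 mulrA.
have : 0 < m / 2 * tnorm H by rewrite mulr_gt0 // divr_gt0.
rewrite ler_norml => k0 k1 /andP[k2 k3]; lra.
Qed.

Lemma LKK_opt i : LKK Ks i = 0.
Proof.
have := grad_opt i; rewrite /grad => /(congr1 (fun M => M *m invmx (X Ks i))).
rewrite mul0mx -scalemxAl mulmxK; last exact/posdef_unit/XK_posdef.
by move=> /eqP; rewrite scaler_eq0 pnatr_eq0 /= => /eqP.
Qed.

Lemma cost_coercive : exists2 m, 0 < m & forall K, stab K ->
  m * tinner (fun i => K i - Ks i) (fun i => K i - Ks i) <= C K - C Ks.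
Proof.
have [lam lam0 hlam] := posdef_gaps X0_posdef.
have [mu mu0 hmu] := posdef_gaps hR.
exists (lam * mu); first exact: mulr_gt0.
move=> K sK; rewrite cost_diff // mulr_sumr; apply: ler_sum => i _.
rewrite /defect LKK_opt trmx0 mulmx0 mul0mx !addr0.
have gS := SK_gap sKs (hmu i).
apply: le_trans (tr_ge (XK_gap sK (hlam i)) (pos_conj _ (posdef_pos (gap_posdef mu0 gS)))).
by rewrite -mulrA ler_wpM2l ?(ltW lam0) // tr_conj_ge.
Qed.

Lemma complete_square n m (S : 'M[R]_n) (D E : 'M[R]_(n, m)) : S^T = S -> S \in unitmx ->
  D^T *m S *m D + (D^T *m E + E^T *m D) =
  (D + invmx S *m E)^T *m S *m (D + invmx S *m E) - E^T *m invmx S *m E.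
Proof.
move=> sS uS; rewrite trmxD trmx_mul trmx_inv sS !mulmxDl !mulmxDr.
rewrite -!(mulmxA _ S) (mulmxA S (invmx S)) mulmxV // mul1mx.
rewrite -!(mulmxA _ (invmx S)) !(mulmxA (invmx S) S) mulVmx // !mul1mx.
by apply/matrixP => a b; rewrite !(addmxE, oppmxE); ring.
Qed.

(** [cost_diff] from K to Ks carries the weight X^{Ks}, so b does not depend on K; the completed
    square is nonnegative and is dropped. *)
Lemma gradient_dominance : exists2 b, 0 < b & forall K, stab K ->
  C K - C Ks <= b * \sum_i \tr ((LKK K i)^T *m invmx (SK K i) *m LKK K i).
Proof.
have [mu mu0 hmu] := posdef_gaps hR.
have s0 : 0 <= \sum_i nrm (X Ks i) by apply: sumr_ge0 => i _; exact: nrm_ge0.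
exists (2 * \sum_i nrm (X Ks i) + 1); first by rewrite ltr_wpDl // mulr_ge0.
move=> K sK; rewrite -opprB lerNl cost_diff // mulr_sumr -sumrN; apply: ler_sum => i _.
have gS := SK_gap sK (hmu i); have pS := gap_posdef mu0 gS.
rewrite /defect (complete_square _ _ (proj1 pS) (posdef_unit pS)).
move: (LKK K i) (Ks i - K i) => l D; rewrite mulmxBr linearB /=.
apply: le_trans (_ : 0 - \tr (X Ks i *m (l^T *m invmx (SK K i) *m l)) <= _);
  last first.
  rewrite lerD2r; apply: tr_pos; first exact: XK_posdef.
  exact/pos_conj/posdef_pos.
have pI : pos (l^T *m invmx (SK K i) *m l) by apply/pos_conj/(inv_pos mu0 gS).
rewrite sub0r lerN2; apply: le_trans (tr_le (XK_sym i sKs) pI) _.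
rewrite ler_wpM2r ?pos_tr_ge0 // lerD2r ler_wpM2l // (bigD1 i) //= lerDl.
by apply: sumr_ge0 => j _; exact: nrm_ge0.
Qed.

(** The three fields are all of the form -2 Y, with Y = L X^K, S^-1 L and L respectively. *)
Lemma tinner_grad_scaled K (Y : gainT) : stab K ->
  tinner (grad K) (fun i => - (2 *: Y i)) =
  - (4 * \sum_i \tr (X K i *m ((LKK K i)^T *m Y i))).
Proof.
move=> sK; rewrite /tinner mulr_sumr -sumrN; apply: eq_bigr => i _.
rewrite /grad linearZ /= trmx_mul XK_sym // mulmxN linearN /= -scalemxAl -scalemxAr.
by rewrite !mxtraceZ mulrA -natrM mulmxA.
Qed.

(** The rate combines |L X|^2 >= lam^2 |L|^2 with tr(L^T S^-1 L) <= |L|^2 / mu. *)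
Lemma grad_flow_decay : exists2 alpha, 0 < alpha & forall K, stab K ->
  tinner (grad K) (fun i => - grad K i) <= - (alpha * (C K - C Ks)).
Proof.
have [lam lam0 hlam] := posdef_gaps X0_posdef.
have [mu mu0 hmu] := posdef_gaps hR.
have [b b0 hb] := gradient_dominance.
exists (4 * lam ^+ 2 * mu / b); first by rewrite divr_gt0 // !mulr_gt0 // exprn_gt0.
move=> K sK; rewrite (tinner_grad_scaled (fun i => LKK K i *m X K i)) // lerN2.
apply: le_trans (ler_wpM2l _ (hb K sK)) _.
  by rewrite divr_ge0 ?(ltW b0) // !mulr_ge0 ?(ltW lam0) ?(ltW mu0) // exprn_ge0 // ltW.
rewrite mulrA mulfVK ?gt_eqF // -!mulrA ler_wpM2l // !mulr_sumr; apply: ler_sum => i _.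
have hX := XK_gap sK (hlam i).
apply: le_trans (_ : lam ^+ 2 * sq (LKK K i) <= _).
  rewrite expr2 -mulrA !ler_wpM2l ?(ltW lam0) // -ler_pdivlMl //.
  exact: (tr_conj_inv_le mu0 (SK_gap sK (hmu i))).
apply: le_trans (sq_mul_ge _ (XK_sym i sK) lam0 hX) _.
by rewrite /sq trmx_mul XK_sym // !mulmxA.
Qed.

(** Here the dominance weight S^-1 appears by itself, so mu does not enter the rate. *)
Lemma gn_flow_decay : exists2 alpha, 0 < alpha & forall K, stab K ->
  tinner (grad K) (fun i => - (2 *: (invmx (SK K i) *m LKK K i))) <= - (alpha * (C K - C Ks)).
Proof.
have [lam lam0 hlam] := posdef_gaps X0_posdef.
have [mu mu0 hmu] := posdef_gaps hR.
have [b b0 hb] := gradient_dominance.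
exists (4 * lam / b); first by rewrite divr_gt0 // !mulr_gt0.
move=> K sK; rewrite tinner_grad_scaled // lerN2.
apply: le_trans (ler_wpM2l _ (hb K sK)) _.
  by rewrite divr_ge0 ?(ltW b0) // mulr_ge0 // ltW.
rewrite mulrA mulfVK ?gt_eqF // -!mulrA ler_wpM2l // !mulr_sumr; apply: ler_sum => i _.
rewrite (mulmxA (LKK K i)^T); apply: tr_ge; first exact: XK_gap.
exact/pos_conj/(inv_pos mu0 (SK_gap sK (hmu i))).
Qed.

Lemma npg_flow_decay : exists2 alpha, 0 < alpha & forall K, stab K ->
  tinner (grad K) (fun i => - (2 *: LKK K i)) <= - (alpha * (C K - C Ks)).
Proof.
have [lam lam0 hlam] := posdef_gaps X0_posdef.
have [mu mu0 hmu] := posdef_gaps hR.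
have [b b0 hb] := gradient_dominance.
exists (4 * lam * mu / b); first by rewrite divr_gt0 // !mulr_gt0.
move=> K sK; rewrite (tinner_grad_scaled (fun i => LKK K i)) // lerN2.
apply: le_trans (ler_wpM2l _ (hb K sK)) _.
  by rewrite divr_ge0 ?(ltW b0) // !mulr_ge0 // ltW.
rewrite mulrA mulfVK ?gt_eqF // -!mulrA ler_wpM2l // !mulr_sumr; apply: ler_sum => i _.
apply: le_trans (tr_ge (XK_gap sK (hlam i)) (pos_gram _)).
rewrite ler_wpM2l ?(ltW lam0) // -ler_pdivlMl //.
exact: (tr_conj_inv_le mu0 (SK_gap sK (hmu i))).
Qed.

End Optimal.

(** * The cost along a curve *)

Lemma costR_cvg (Fl : set_system R) (FF : Filter Fl) (Kt : R -> gainT) K : stab K ->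
  (forall i a b, (fun s => Kt s i a b) @ Fl --> K i a b) ->
  (fun s => C (Kt s)) @ Fl --> C K.
Proof.
move=> sK h; have [del [del0 del1 hst hb]] := near_blip (C K).
have hP i : blips (C K) del (fun K => PK K i) by case: (hb i).
have [M M0 hM] := costR_lip hP hst.
have hg : (fun s => gnrm (fun i => Kt s i - K i)) @ Fl --> (0 : R).
  rewrite /gnrm; apply: cvg_sum0 => i; rewrite /nrm; apply: cvg_sum0 => a.
  apply: cvg_sum0 => b.
  rewrite (_ : (fun s => _) = fun s => `|Kt s i a b - K i a b|); last first.
    by apply/funext => s; rewrite !mxE.
  have hn : (fun s => Kt s i a b - K i a b) @ Fl --> (0 : R).
    by rewrite -(subrr (K i a b)); apply: cvgB; [exact: h|exact: cvg_cst].
  by rewrite -(normr0 R); apply: (cvg_norm hn).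
apply/cvgrPdist_le => e e0.
have M1 : 0 < M + 1 by lra.
have m0 : 0 < Num.min del (e / (M + 1)) by rewrite lt_min del0 divr_gt0.
move/cvgrPdist_le: hg => /(_ _ m0); apply: filterS => s.
rewrite sub0r normrN ger0_norm ?gnrm_ge0 // le_min => /andP[g1 g2].
rewrite distrC; apply: le_trans (hM (K, Kt s) _) _; first by split.
apply: le_trans (_ : (M + 1) * gdist (K, Kt s) <= _).
  by rewrite ler_wpM2r ?gdist_ge0 // lerDl.
by rewrite mulrC -ler_pdivlMr.
Qed.

Lemma costR_within (Kt : R -> gainT) (S : set R) :
  (forall s, S s -> stab (Kt s)) ->
  (forall i a b, {within S, continuous (fun s => Kt s i a b)}) ->
  {within S, continuous (fun s => C (Kt s))}.
Proof.
move=> hs hc; apply/subspace_continuousP => s Ss.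
apply: costR_cvg; first exact: hs.
by move=> i a b; have /subspace_continuousP := hc i a b; apply.
Qed.

(** With q h the difference quotient of [Kt], the expansion of C gives <grad, q h> up to O(|h| |q
    h|^2), and q h tends to D. *)
Lemma costR_derive (Kt : R -> gainT) (D : gainT) (t : R) : stab (Kt t) ->
  (forall i a b, is_derive t (1 : R^o) (fun s => Kt s i a b) (D i a b)) ->
  is_derive t (1 : R^o) (fun s => C (Kt s)) (tinner (grad (Kt t)) D).
Proof.
move=> sK hD; have [del [M [del0 M0 hM]]] := grad_expansion sK.
pose q h : gainT := fun i => h^-1 *: (Kt (h + t) i - Kt t i).
have hq i a b : (fun h => q h i a b) @ 0^' --> D i a b.
  have [dK eK] := hD i a b.
  have := dK; rewrite /derivable => /cvg_ex[l hl].
  have : l = D i a b.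
    by rewrite -eK /derive; apply/esym/(cvg_lim (@Rhausdorff R)).
  move=> <-; apply: cvg_trans hl; apply: near_eq_cvg; apply: nearW => h.
  by rewrite /q !mxE /GRing.scale /= mulr1.
have hqg : (fun h => tinner (grad (Kt t)) (q h)) @ 0^' --> tinner (grad (Kt t)) D.
  rewrite /tinner /mxtrace; apply: cvg_sum_fin => i; apply: cvg_sum_fin => b.
  rewrite (_ : (fun s => _) = fun s => \sum_a (grad (Kt t) i)^T b a * q s i a b); last first.
    by apply/funext => s; rewrite mxE.
  rewrite mxE; apply: cvg_sum_fin => a; apply: cvgM; first exact: cvg_cst.
  exact: hq.
have hqn : (fun h => gnrm (q h)) @ 0^' --> gnrm D.
  rewrite /gnrm /nrm; apply: cvg_sum_fin => i; apply: cvg_sum_fin => a; apply: cvg_sum_fin => b.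
  by apply: cvg_norm; exact: hq.
have h0 : (fun h : R => h) @ 0^' --> (0 : R) by apply: cvg_within.
have ha : (fun h : R => `|h|) @ 0^' --> (0 : R).
  by rewrite -[X in _ --> X](normr0 R); exact: (cvg_norm h0).
have gK h : h != 0 -> gnrm (fun i => Kt (h + t) i - Kt t i) = `|h| * gnrm (q h).
  move=> hn; rewrite /gnrm mulr_sumr; apply: eq_bigr => i _.
  by rewrite nrmZ mulrA -normrM mulfV // normr1 mul1r.
have hsmall : \forall h \near 0^', gnrm (fun i => Kt (h + t) i - Kt t i) <= del.
  have hc : (fun h : R => `|h| * gnrm (q h)) @ 0^' --> (0 : R).
    by rewrite -[X in _ --> X](mul0r (gnrm D)); exact: (cvgM ha hqn).
  move/cvgrPdist_le: hc => /(_ _ del0) hc; near=> h.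
  have hn : h != 0 by near: h; exact: nbhs_dnbhs_neq.
  rewrite gK //; have : `|0 - `|h| * gnrm (q h)| <= del by near: h.
  by rewrite sub0r normrN ger0_norm // mulr_ge0 // gnrm_ge0.
suff hc : (fun h => h^-1 *: (C (Kt (h + t)) - C (Kt t)) : R) @ 0^'
    --> tinner (grad (Kt t)) D.
  have e : (fun h : R => h^-1 *: ((fun s => C (Kt s)) (h *: (1 : R^o) + t) - C (Kt t)) : R) =
    (fun h => h^-1 *: (C (Kt (h + t)) - C (Kt t)) : R).
    by apply/funext => h; rewrite /GRing.scale /= mulr1.
  apply: DeriveDef.
    by rewrite /derivable; apply/cvg_ex; exists (tinner (grad (Kt t)) D); rewrite e.
  by rewrite /derive e; exact: (cvg_lim (@Rhausdorff R)).
have hr : (fun h => M * (`|h| * gnrm (q h) ^+ 2)) @ 0^' --> (0 : R).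
  have e : (0 : R) = M * (0 * gnrm D ^+ 2) by rewrite mul0r mulr0.
  rewrite [X in _ --> X]e; apply: cvgM; first exact: cvg_cst.
  apply: cvgM; first exact: ha.
  rewrite expr2; apply: (cvgM hqn hqn).
have hd : (fun h => h^-1 *: (C (Kt (h + t)) - C (Kt t)) - tinner (grad (Kt t)) (q h) : R)
    @ 0^' --> (0 : R).
  apply/norm_cvg0P; apply: (squeeze_cvgr _ (cvg_cst 0) hr); near=> h.
  have hn : h != 0 by near: h; exact: nbhs_dnbhs_neq.
  rewrite normr_ge0 /=.
  have [|_] := hM (Kt (h + t)); first by near: h.
  rewrite gK // /q tinnerZr => hle.
  rewrite -[X in _ - X]/(h^-1 *: (tinner (grad (Kt t)) (fun i => Kt (h + t) i - Kt t i) : R^o)).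
  rewrite -scalerBr normrZ normfV ler_pdivrMl ?normr_gt0 //.
  apply: le_trans hle _; rewrite exprMn expr2 !mulrA.
  by rewrite [M * `|h|]mulrC.
rewrite (_ : (fun h => _) = fun h => (h^-1 *: (C (Kt (h + t)) - C (Kt t))
     - tinner (grad (Kt t)) (q h)) + tinner (grad (Kt t)) (q h) :> R); last first.
  by apply/funext => h; rewrite subrK.
by rewrite -[tinner _ D]add0r; exact: (cvgD hd hqg).
Unshelve. all: by end_near. Qed.

(** * Global existence and convergence for a cost-decreasing field *)

Section Flow.
Variables (Ks K0 : gainT).
Hypotheses (sKs : stab Ks) (minKs : forall K, stab K -> C Ks <= C K) (sK0 : stab K0).
Variables (F : gainT -> gainT) (alpha : R).
Hypotheses (alpha0 : 0 < alpha) (F_decay : forall K, stab K ->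
  tinner (grad K) (F K) <= - (alpha * (C K - C Ks))).
(** Relative to given bounds on K, P^K and X^K, so that each flow only has to present its field as
    an expression in these. *)
Hypothesis F_blip : forall c del, (forall j, near_pair c del j -> stab j.2) ->
  (forall i, [/\ blips c del (fun K => K i), blips c del (fun K => PK K i)
    & blips c del (fun K => X K i)]) ->
  forall i, blips c del (fun K => F K i).

Lemma flow_exp_conv (Kt : R -> gainT) : Kt 0 = K0 ->
  (forall t : R, 0 <= t -> stab (Kt t)) ->
  (forall i a b, {within [set t : R | 0 <= t], continuous (fun s => Kt s i a b)}) ->
  (forall (t : R) i a b, 0 < t ->
     is_derive t (1 : R^o) (fun s => Kt s i a b) (F (Kt t) i a b)) ->
  exp_conv Kt Ks.
Proof.
move=> e0 hs hc hd.
have [m m0 hm] := cost_coercive sKs minKs.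
have decay t : 0 <= t -> (C (Kt t) - C Ks) * expR (alpha * t) <= C K0 - C Ks.
  move=> t0.
  have := @exp_decay R (fun s => C (Kt s) - C Ks) (fun s => tinner (grad (Kt s)) (F (Kt s)))
    alpha t t0 _ _ (fun s s0 _ => F_decay (hs s (ltW s0))).
  cbv beta; rewrite e0; apply.
  - move=> s s0 _.
    have d1 := costR_derive (hs s (ltW s0)) (fun i a b => hd s i a b s0).
    have d2 : is_derive s (1 : R^o) (cst (C Ks)) 0 by apply: is_derive_cst.
    by have d3 := is_deriveB d1 d2; rewrite subr0 in d3.
  - have c1 : {within `[0, t], continuous (fun s => C (Kt s))}.
      apply: costR_within => [s|i a b].
        by rewrite /= in_itv /= => /andP[s0 _]; exact: hs.
      apply: continuous_subspaceW (hc i a b) => s.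
      by rewrite /= in_itv /= => /andP[].
    by move=> s; apply: cvgB; [exact: c1|exact: cvg_cst].
have A0 : 0 <= (C K0 - C Ks) / m.
  by rewrite divr_ge0 ?(ltW m0) // subr_ge0 minKs.
(* Coercivity bounds the squared distance by the cost gap over m; the root halves the rate. The
   summand 1 keeps the constant positive when K0 is already optimal. *)
exists (Num.sqrt ((C K0 - C Ks) / m) + 1), (alpha / 2); split.
  by rewrite ltr_wpDl // sqrtr_ge0.
split; first by rewrite divr_gt0.
move=> t t0; have h1 := hm _ (hs t t0); have h2 := decay t t0.
apply: le_trans (_ : Num.sqrt ((C K0 - C Ks) / m) * expR (- (alpha / 2 * t)) <= _); last first.
  by rewrite ler_wpM2r ?expR_ge0 // lerDl.
rewrite -ler_sqr ?nnegrE ?sqrtr_ge0 ?mulr_ge0 ?sqrtr_ge0 ?expR_ge0 //.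
have e : expR (- (alpha / 2 * t)) ^+ 2 = (expR (alpha * t))^-1.
  by rewrite expr2 -expRD -expRN; congr expR; field.
have gen (T a b w : R) : 0 < w -> m * T <= a -> a * w <= b -> T <= b / m * w^-1.
  move=> w0 k1 k2; rewrite mulrAC ler_pdivlMr // ler_pdivlMr //.
  by apply: le_trans k2; rewrite ler_wpM2r ?(ltW w0) // mulrC.
rewrite tnorm_sqr exprMn sqr_sqrtr // e.
exact: gen (expR_gt0 _) h1 h2.
Qed.

Let c := C K0 + 1.
(** Equals 1 up to level C(K0) and 0 from C(K0) + 1 on; piecewise linear in C, hence Lipschitz
    wherever C is. *)
Definition cutoff K : R := Num.min (Num.max (C K0 + 1 - C K) 0) 1.
(** Extended by 0 outside the stabilizing gains; this creates no jump because a neighbourhood of {C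
    <= c} of uniform radius is stabilizing. *)
Definition cut_field K : gainT :=
  fun i => if pselect (stab K) then cutoff K *: F K i else 0.

Lemma cutoff_itv K : 0 <= cutoff K <= 1.
Proof. by rewrite /cutoff le_min ler01 le_max lexx orbT ge_min lexx orbT. Qed.

Lemma cutoff1 K : C K <= C K0 -> cutoff K = 1.
Proof.
by move=> h; rewrite /cutoff min_r // le_max -addrA addrC -addrA lerDl addrC subr_ge0 h.
Qed.

Lemma cut_fieldE K i : stab K -> cut_field K i = cutoff K *: F K i.
Proof. by rewrite /cut_field; case: pselect. Qed.

Lemma cut_field0 K i : ~ (stab K /\ C K <= c) -> cut_field K i = 0.
Proof.
rewrite /cut_field; case: pselect => // sK h.
have {h} : c < C K by rewrite ltNge; apply/negP => h'; apply: h.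
by rewrite -subr_lt0 => h; rewrite /cutoff max_r ?ltW // min_l ?scale0r.
Qed.

Lemma gdistC K K' : gdist (K, K') = gdist (K', K).
Proof. by apply: eq_bigr => i _; rewrite nrmB. Qed.

(** If one gain lies in {C <= c}, the uniform bounds apply up to distance del, and beyond del the
    trivial bound 2 M is at most 2 M / del times the distance. If neither does, both values are
    0. *)
Lemma cut_field_lip : exists M L, [/\ 0 <= M, 0 <= L,
  forall K i, nrm (cut_field K i) <= M &
  forall K K' i, nrm (cut_field K' i - cut_field K i) <= L * gdist (K, K')].
Proof.
have [del [del0 del1 hst hb]] := near_blip c.
have hF := F_blip hst hb.
have hP i : blips c del (fun K => PK K i) by case: (hb i).
have [Lc Lc0 hLc] := costR_lip hP hst.
have [M M0 hM] : exists2 M, 0 <= M &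
    forall i j, near_pair c del j -> nrm (F j.1 i) <= M.
  by apply: bd_unif => i; case: (hF i).
have [Lf Lf0 hLf] : exists2 M, 0 <= M &
    forall i j, near_pair c del j -> nrm (F j.2 i - F j.1 i) <= M * gdist j.
  by apply: (sm_unif gdist_ge0) => i; case: (hF i).
have g0 K : gdist (K, K) = 0.
  by rewrite /gdist /gnrm big1 // => i _ /=; rewrite subrr nrm0.
have hFM K i : stab K -> C K <= c -> nrm (F K i) <= M.
  move=> sK hK; apply: (hM i (K, K)); split=> //.
  by rewrite -/(gdist (K, K)) g0 ltW.
have hbd K i : nrm (cut_field K i) <= M.
  have [[sK hK]|h] := pselect (stab K /\ C K <= c); last by rewrite cut_field0 // nrm0.
  rewrite cut_fieldE // nrmZ; have /andP[h0 h1] := cutoff_itv K.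
  by rewrite ger0_norm //; apply: le_trans (hFM K i sK hK); rewrite ler_piMl ?nrm_ge0.
have far K K' i : nrm (cut_field K' i - cut_field K i) <= 2 * M.
  apply: le_trans (nrmD _ _) _; rewrite nrmN.
  by have := hbd K i; have := hbd K' i; lra.
have half K K' i : stab K -> C K <= c ->
    nrm (cut_field K' i - cut_field K i) <= (Lf + Lc * M + 2 * M / del) * gdist (K, K').
  move=> sK hK; have [hd|hd] := leP (gdist (K, K')) del; last first.
    apply: le_trans (far K K' i) _.
    apply: le_trans (_ : 2 * M / del * gdist (K, K') <= _).
      by rewrite mulrAC ler_pdivlMr // ler_wpM2l ?mulr_ge0 // ltW.
    by rewrite ler_wpM2r ?gdist_ge0 // lerDr addr_ge0 // mulr_ge0.
  have Dj : near_pair c del (K, K') by split.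
  have sK' := hst _ Dj; rewrite /= in sK'.
  apply: le_trans (_ : (Lf + Lc * M) * gdist (K, K') <= _); last first.
    by rewrite ler_wpM2r ?gdist_ge0 // lerDl divr_ge0 ?mulr_ge0 // ltW.
  rewrite !cut_fieldE //.
  have -> : cutoff K' *: F K' i - cutoff K *: F K i =
     cutoff K' *: (F K' i - F K i) + (cutoff K' - cutoff K) *: F K i.
    move: (cutoff K') (cutoff K) (F K' i) (F K i) => a b f g.
    by rewrite scalerBr scalerBl addrA subrK.
  apply: le_trans (nrmD _ _) _; rewrite !nrmZ mulrDl lerD //.
    have /andP[h0 h1] := cutoff_itv K'; rewrite ger0_norm //.
    by apply: le_trans (hLf i _ Dj); rewrite ler_piMl ?nrm_ge0.
  rewrite mulrAC ler_pM ?nrm_ge0 ?hFM //.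
  apply: le_trans (norm_min_le _ _ _) _; apply: le_trans (norm_max_le _ _ _) _.
  have e (x y z : R) : `|x - y - (x - z)| = `|y - z|.
    by rewrite opprB addrC addrA subrK distrC.
  rewrite e; exact: hLc Dj.
exists M, (Lf + Lc * M + 2 * M / del); split=> //.
  by rewrite !addr_ge0 ?divr_ge0 ?mulr_ge0 // ltW.
move=> K K' i.
have [[sK hK]|hK] := pselect (stab K /\ C K <= c); first exact: half.
have [[sK' hK']|hK'] := pselect (stab K' /\ C K' <= c).
  by rewrite nrmB gdistC half.
rewrite !cut_field0 // subrr nrm0 mulr_ge0 ?gdist_ge0 //.
by rewrite !addr_ge0 ?divr_ge0 ?mulr_ge0 // ltW.
Qed.

Lemma flow_exists : exists Kt : R -> gainT, [/\ Kt 0 = K0,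
  forall t : R, 0 <= t -> stab (Kt t),
  forall i a b, continuous (fun s => Kt s i a b) &
  forall (t : R) i a b, 0 < t ->
     is_derive t (1 : R^o) (fun s => Kt s i a b) (F (Kt t) i a b)].
Proof.
have [M [L [M0 L0 hM hL]]] := cut_field_lip.
pose I := ('I_Ns * ('I_k * 'I_d))%type.
pose tomx (x : I -> R) : gainT := fun i => \matrix_(a, b) x (i, (a, b)).
pose Fv x (j : I) := cut_field (tomx x) j.1 j.2.1 j.2.2.
pose N : R := (Ns * (k * d))%:R.
have N0 : 0 <= N by [].
have gd x y e : (forall j, `|x j - y j| <= e) -> gdist (tomx y, tomx x) <= N * e.
  by move=> h; apply: gnrm_le => i a b /=; rewrite !mxE; exact: h.
have FvM x j : `|Fv x j| <= M by apply: le_trans (le_nrm _ _ _) (hM _ _).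
have FvL x y e : (forall j, `|x j - y j| <= e) ->
    forall j, `|Fv x j - Fv y j| <= (L * N + 1) * e.
  move=> h j; have e0 : 0 <= e by apply: le_trans (h j).
  apply: le_trans (_ : L * (N * e) <= _); last by rewrite mulrA ler_wpM2r // lerDl.
  apply: le_trans (ler_wpM2l L0 (gd _ _ _ h)); apply: le_trans (hL _ _ j.1).
  have := le_nrm (cut_field (tomx x) j.1 - cut_field (tomx y) j.1) j.2.1 j.2.2.
  by rewrite addmxE oppmxE.
have L1 : 0 < L * N + 1 by rewrite ltr_wpDl // mulr_ge0.
have [u [u0 lu du]] := picard_lindelof (fun j : I => K0 j.1 j.2.1 j.2.2) M0 L1 FvM FvL.
pose Kt t := tomx (u t).
have Kt0 : Kt 0 = K0.
  by apply/funext => i; apply/matrixP => a b; rewrite mxE u0.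
have ent i a b : (fun s => Kt s i a b) = fun s => u s (i, (a, b)).
  by apply/funext => s; rewrite mxE.
have cK i a b : continuous (fun s => Kt s i a b).
  by rewrite ent; exact: (lipschitz_time_continuous (lu (i, (a, b)))).
have dK (t : R) i a b : 0 < t ->
    is_derive t (1 : R^o) (fun s => Kt s i a b) (cut_field (Kt t) i a b).
  by move=> t0; rewrite ent; exact: (du t (i, (a, b))).
have [del [del0 del1 hst hb]] := near_blip c.
(* Entries move at speed at most M and there are N of them, so in time h the gain moves by at most N
   M h < del. *)
pose h := del / (N * M + 1).
have NM : 0 < N * M + 1 by rewrite ltr_wpDl // mulr_ge0.
have h0 : 0 < h by rewrite divr_gt0.
(* Over one step of length h the curve stays within del of a gain of cost at most C(K0), hence
   stabilizing; only then can C be differentiated and seen not to increase, which restores the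
   hypothesis for the next step. *)
have inv n (t : R) : 0 <= t -> t <= n%:R * h -> stab (Kt t) /\ C (Kt t) <= C K0.
  elim: n t => [|n IH] t t0 tn.
    have -> : t = 0 by apply/eqP; rewrite eq_le t0 andbT; rewrite mul0r in tn.
    by rewrite Kt0.
  have [|lt] := leP t (n%:R * h); first exact: IH.
  set t1 := n%:R * h in lt *.
  have t10 : 0 <= t1 by rewrite mulr_ge0 // ltW.
  have [sT cT] := IH t1 t10 (lexx _).
  have hs s : t1 <= s -> s <= t -> stab (Kt s).
    move=> s1 s2; apply: (hst (Kt t1, Kt s)); split=> //=.
      by apply: le_trans cT _; rewrite lerDl.
    apply: le_trans (gd _ _ (M * `|s - t1|) (fun j => lu j s t1)) _.
    rewrite ger0_norm ?subr_ge0 // mulrA.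
    apply: le_trans (_ : (N * M + 1) * h <= _); last by rewrite mulrC mulfVK // gt_eqF.
    rewrite ler_pM ?mulr_ge0 ?subr_ge0 // ?lerDl // lerBlDl; apply: le_trans s2 _.
    by move: tn; rewrite -natr1 mulrDl mul1r.
  split; first by apply: hs => //; exact: ltW.
  apply: le_trans cT; apply: (@derive_le0_le R (fun s => C (Kt s))
    (fun s => tinner (grad (Kt s)) (cut_field (Kt s))) t1 t (ltW lt)).
  - move=> s s1 s2; apply: costR_derive; first by apply: hs; exact: ltW.
    by move=> i a b; apply: dK; exact: le_lt_trans s1.
  - apply: costR_within => [s|i a b]; last exact: continuous_subspaceT.
    by rewrite /= in_itv /= => /andP[]; exact: hs.
  - move=> s s1 s2; have sK := hs s (ltW s1) (ltW s2).
    have -> : cut_field (Kt s) = fun i => cutoff (Kt s) *: F (Kt s) i.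
      by apply/funext => i; rewrite cut_fieldE.
    rewrite tinnerZr; have /andP[k0 _] := cutoff_itv (Kt s).
    rewrite mulr_ge0_le0 //; apply: le_trans (F_decay sK) _.
    by rewrite oppr_le0 mulr_ge0 ?(ltW alpha0) // subr_ge0 minKs.
have {}inv (t : R) : 0 <= t -> stab (Kt t) /\ C (Kt t) <= C K0.
  move=> t0; apply: (inv (Num.bound (t / h))) => //.
  by rewrite -ler_pdivrMr // ltW // archi_boundP // divr_ge0 // ltW.
exists Kt; split=> // [t /inv[]//|t i a b t0].
have [sK cK'] := inv t (ltW t0); have := dK t i a b t0.
by rewrite cut_fieldE // cutoff1 // scale1r.
Qed.

Lemma flow_converges_of (Frel : gainT -> gainT -> Prop) :
  (forall K D, stab K -> Frel K D <-> D = F K) ->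
  flow_converges A B p Frel K0 Ks.
Proof.
move=> hF; split.
  have [Kt [h1 h2 h3 h4]] := flow_exists; exists Kt; split=> //; split=> //; split.
    by move=> i a b; exact: continuous_subspaceT.
  move=> t t0; exists (F (Kt t)); split; first by move=> i a b; exact: h4.
  by apply/hF => //; exact/h2/ltW.
move=> Kt [h1 [h2 [h3 h4]]]; apply: flow_exp_conv => // t i a b t0.
by have [D [hD /hF e]] := h4 t t0; rewrite -e //; exact/h2/ltW.
Qed.

End Flow.

(** * The three flows *)

Section Flows.
Variables (Ks K0 : gainT).
Hypotheses (sKs : stab Ks) (sK0 : stab K0).
Hypothesis minKs : forall K, stab K ->
  (cost A B p pi Sigma0 Q Rc Ks <= cost A B p pi Sigma0 Q Rc K)%E.

Lemma costR_min K : stab K -> C Ks <= C K.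
Proof.
move=> sK; have := minKs sK; rewrite (costE sKs) (costE sK) lee_fin.
by rewrite (costR_QK sKs) (costR_QK sK).
Qed.

Lemma grad_flow_converges :
  flow_converges A B p (grad_flow A B p pi Sigma0 Q Rc) K0 Ks.
Proof.
have [alpha a0 ha] := grad_flow_decay sKs.
apply: (flow_converges_of sKs costR_min sK0 a0 ha) => [c del _ h i|K D sK].
  apply/blipN/blipZ/(blipM gdist_ge0); last by case: (h i).
  by apply: blip_LKK => [l|]; [case: (h l)|case: (h i)].
split=> [hD|->].
  have e := is_grad_uniq hD (is_grad_grad sK).
  by apply/funext => i; rewrite -e opprK.
rewrite /grad_flow (_ : (fun i => _) = grad K); first exact: is_grad_grad.
by apply/funext => i; rewrite opprK.
Qed.

Lemma gn_flow_converges : flow_converges A B p (gn_flow A B p Q Rc) K0 Ks.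
Proof.
have [alpha a0 ha] := gn_flow_decay sKs.
have [mu mu0 hmu] := posdef_gaps hR.
apply: (flow_converges_of sKs costR_min sK0 a0 ha) => [c del hs h i|K D sK].
  have hP l : blips c del (fun K => PK K l) by case: (h l).
  apply/blipN/blipZ/(blipM gdist_ge0); last by apply: blip_LKK => //; case: (h i).
  apply: (blip_inv gdist_ge0 mu0 _ (blip_SK i hP)) => j Dj.
  by have [s1 _ _] := Dj; split; apply: SK_gap => //; exact: hs.
split=> [[P [hP hD]]|->]; last by exists (PK K); split=> //; exact: is_PK_PK.
by apply/funext => i; rewrite hD (is_PK_uniq sK hP).
Qed.

Lemma npg_flow_converges :
  flow_converges A B p (npg_flow A B p pi Sigma0 Q Rc) K0 Ks.
Proof.
have [alpha a0 ha] := npg_flow_decay sKs.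
have e K i : stab K -> grad K i *m invmx (X K i) = 2 *: LKK K i.
  by move=> sK; rewrite -scalemxAl mulmxK //; exact/posdef_unit/XK_posdef.
apply: (flow_converges_of sKs costR_min sK0 a0 ha) => [c del _ h i|K D sK].
  by apply/blipN/blipZ/blip_LKK => [l|]; [case: (h l)|case: (h i)].
split=> [[G0 [hG hD]]|->].
  by apply/funext => i; rewrite hD (is_grad_uniq hG (is_grad_grad sK)) e.
exists (grad K); split=> [|i]; first exact: is_grad_grad.
by rewrite e.
Qed.

End Flows.

End Control.

Theorem theorem4 (R : realType) (Ns d k : nat)
  (A : 'I_Ns -> 'M[R]_d) (B : 'I_Ns -> 'M[R]_(d, k))
  (p : 'I_Ns -> 'I_Ns -> R) (pi : 'I_Ns -> R) (Sigma0 : 'M[R]_d)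
  (Q : 'I_Ns -> 'M[R]_d) (Rc : 'I_Ns -> 'M[R]_k)
  (K0 Kstar : 'I_Ns -> 'M[R]_(k, d)) :
  (0 < Ns)%N ->
  stochastic p -> init_distr pi -> posdef Sigma0 ->
  (forall i, posdef (Q i)) -> (forall i, posdef (Rc i)) ->
  (exists K, stabilizing A B p K) ->
  stabilizing A B p Kstar ->
  (forall K, stabilizing A B p K ->
     (cost A B p pi Sigma0 Q Rc Kstar <= cost A B p pi Sigma0 Q Rc K)%E) ->
  stabilizing A B p K0 ->
  flow_converges A B p (grad_flow A B p pi Sigma0 Q Rc) K0 Kstar /\
  flow_converges A B p (gn_flow A B p Q Rc) K0 Kstar /\
  flow_converges A B p (npg_flow A B p pi Sigma0 Q Rc) K0 Kstar.
Proof.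
move=> _ hp hpi hS hQ hR _ sKs minKs sK0; split.
  exact: grad_flow_converges.
by split; [exact: (gn_flow_converges hp hpi hS hQ hR sKs sK0 minKs)|exact: npg_flow_converges].
Qed.
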